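(* The exponential generating function of the sequence $\{|B_{SO(2\ell)}\backslash\mathcal{B}_{\mathfrak{so}(2\ell+1)}|\}_{\ell\ge 0}$ is $\frac{e^{\frac{x}{1-2x}}}{1-2x}$; that is, as formal power series, $$\sum_{\ell\ge 0}\frac{|B_{SO(2\ell)}\backslash\mathcal{B}_{\mathfrak{so}(2\ell+1)}|}{\ell!}x^\ell=\frac{e^{\frac{x}{1-2x}}}{1-2x}.$$
   Context: Over $\mathbb{C}$: $SO(2\ell+1)$ is the group of determinant-one linear maps of $\mathbb{C}^{2\ell+1}$ preserving the symmetric bilinear form $\beta$ with $\beta(e_j,e_k)=\delta_{j,-k}$, where $e_1,\dots,e_\ell,e_0,e_{-\ell},\dots,e_{-1}$ is an ordered basis of $\mathbb{C}^{2\ell+1}$. $\mathcal{B}_{\mathfrak{so}(2\ell+1)}$ is the flag variety of $\mathfrak{so}(2\ell+1)$ (variety of Borel subalgebras; a point if $\ell=0$). $SO(2\ell)\subset SO(2\ell+1)$ is the subgroup fixing $e_0$, and $B_{SO(2\ell)}$ is the intersection of $SO(2\ell)$ with the group of upper triangular matrices with respect to the ordered basis above; it is a Borel subgroup of $SO(2\ell)$ (trivial for $\ell=0$, so the $\ell=0$ term equals $1$). $H\backslash X$ denotes the set of $H$-orbits on $X$. The exponential generating function of a sequence $f(\ell)$, $\ell\ge0$, is $\sum_{\ell\ge0}\frac{f(\ell)}{\ell!}x^\ell$. *)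

(* Defs.v *)
From HB Require Import structures.
From mathcomp Require Import all_boot all_order all_algebra.
From mathcomp Require Import all_classical all_reals.
From mathcomp Require Import zify.

Set Implicit Arguments.
Unset Strict Implicit.
Unset Printing Implicit Defensive.

Import Order.TTheory GRing.Theory Num.Theory.
Local Open Scope ring_scope.

(* Lie algebras of square matrices *)

Section MatrixLie.
Variables (F : fieldType) (n : nat).
Implicit Types (A B g : 'M[F]_n) (U V b : {vspace 'M[F]_n}).

Definition lie_bracket A B : 'M[F]_n := A *m B - B *m A.

Definition lie_subalgebra U : Prop :=
  forall A B, A \in U -> B \in U -> lie_bracket A B \in U.

(* By bilinearity, the span of all the brackets of an element of U with an
   element of V. *)
Definition lie_commutator U V : {vspace 'M[F]_n} :=
  (<<[seq lie_bracket A B | A <- vbasis U, B <- vbasis V]>>)%VS.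

Definition derived_series (k : nat) U : {vspace 'M[F]_n} :=
  iter k (fun W => lie_commutator W W) U.

Definition lie_solvable U : Prop := exists k, derived_series k U = 0%VS.

(* Borel subalgebras, i.e. maximal solvable subalgebras, of the Lie algebra
   whose underlying set of matrices is gg. *)
Definition solvable_subalgebra (gg : 'M[F]_n -> Prop) U : Prop :=
  [/\ forall A, A \in U -> gg A, lie_subalgebra U & lie_solvable U].

Definition borel_subalgebra (gg : 'M[F]_n -> Prop) b : Prop :=
  solvable_subalgebra gg b /\
  forall U, solvable_subalgebra gg U -> (b <= U)%VS -> U = b.

(* The adjoint action on subspaces: b |-> g b g^-1. *)
Definition Ad g b : {vspace 'M[F]_n} :=
  (linfun (mulmxr (invmx g) \o mulmx g) @: b)%VS.

Definition Ad_orbit (H : 'M[F]_n -> Prop) b : set {vspace 'M[F]_n} :=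
  [set b' | exists2 g, H g & b' = Ad g b].

End MatrixLie.

(* Odd orthogonal groups; matrices act on column vectors. *)

(* The position i : 'I_(2 l + 1) carries the basis vector e_(blabel l i), so that
   the labels read 1, ..., l, 0, -l, ..., -1. *)
Definition blabel (l : nat) (i : 'I_(l.*2.+1)) : int :=
  if (i < l)%N then i.+1%:Z
  else if i == l :> nat then 0
  else i%:Z - l.*2.+1%:Z.

Section OddOrthogonal.
Variables (F : fieldType) (l : nat).
Notation n := (l.*2.+1).
Implicit Types g X : 'M[F]_n.

Definition beta : 'M[F]_n := \matrix_(i, j) (blabel i == - blabel j)%:R.

Definition in_SO g : Prop := g^T *m beta *m g = beta /\ \det g = 1.

Definition in_so X : Prop := X^T *m beta + beta *m X = 0.

Definition e0 : 'cV[F]_n := \col_i (blabel i == 0)%:R.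

(* SO(2 l), as a subgroup of SO(2 l + 1). *)
Definition in_SO_even g : Prop := in_SO g /\ g *m e0 = e0.

Definition upper_triangular g : Prop := forall i j : 'I_n, (j < i)%N -> g i j = 0.

Definition in_B_SO_even g : Prop := in_SO_even g /\ upper_triangular g.

Definition flag_variety_so : set {vspace 'M[F]_n} :=
  [set b | borel_subalgebra in_so b].

(* B_SO(2 l) \ flag_variety_so(2 l + 1) *)
Definition B_orbits : set (set {vspace 'M[F]_n}) :=
  [set Ad_orbit in_B_SO_even b | b in flag_variety_so]%classic.

End OddOrthogonal.

Arguments flag_variety_so F l : clear implicits.
Arguments B_orbits F l : clear implicits.

Lemma betaE (F : fieldType) (l : nat) (i j : 'I_(l.*2.+1)) :
  beta F l i j = (j == rev_ord i)%:R.
Proof.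
rewrite mxE; congr (_%:R); congr nat_of_bool; rewrite -val_eqE /= /blabel.
by case: i j => i Hi [j Hj] /=; do ?case: ifP; lia.
Qed.

(* Formal power series over rat, as sequences of coefficients *)

Definition fps := nat -> rat.

Definition fps_poly (p : {poly rat}) : fps := fun n => p`_n.

Definition fps_mul (f g : fps) : fps :=
  fun n => \sum_(i < n.+1) f i * g (n - i)%N.

Definition fps_pow (f : fps) (k : nat) : fps :=
  iter k (fps_mul f) (fps_poly 1).

(* The first n coefficients of the inverse of f, for f with a nonzero constant
   term. *)
Fixpoint fps_inv_coefs (f : fps) (n : nat) : seq rat :=
  if n is m.+1 then
    let s := fps_inv_coefs f m in
    rcons s ((f 0%N)^-1 * ((m == 0)%:R - \sum_(i < m) s`_i * f (m - i)%N))
  else [::].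

Definition fps_inv (f : fps) : fps := fun n => (fps_inv_coefs f n.+1)`_n.

Definition fps_div (f g : fps) : fps := fps_mul f (fps_inv g).

(* exp (f) = \sum_k f ^ k / k`! for f with zero constant term; then f ^ k has
   no terms of degree < k, whence the truncation of the sum. *)
Definition fps_exp (f : fps) : fps :=
  fun n => \sum_(k < n.+1) fps_pow f k n / k`!%:R.

Definition egf (a : nat -> nat) : fps := fun n => (a n)%:R / n`!%:R.

Lemma fps_mul_inv (f : fps) : f 0%N != 0 ->
  fps_mul (fps_inv f) f =1 fps_poly 1.
Proof.
move=> f0 n.
have sz m : size (fps_inv_coefs f m) = m.
  by elim: m => //= m IH; rewrite size_rcons IH.
have pre m i : (i < m)%N -> (fps_inv_coefs f m)`_i = fps_inv f i.
  elim: m => // m IH; rewrite ltnS leq_eqVlt => /orP[/eqP->//|im] /=.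
  by rewrite nth_rcons sz im IH.
have -> : fps_poly 1 n = (n == 0)%:R by rewrite /fps_poly coef1.
rewrite /fps_mul big_ord_recr /= subnn {2}/fps_inv /= nth_rcons sz ltnn eqxx.
under [X in _ - X]eq_bigr => i _ do rewrite (pre _ _ (ltn_ord i)).
by rewrite mulrAC mulVf // mul1r addrC subrK.
Qed.

(* Main.v *)
Require Import Defs.
From HB Require Import structures.
From mathcomp Require Import all_boot all_order all_algebra.
From mathcomp Require Import finmap.
From mathcomp Require Import all_classical all_reals.
From mathcomp Require Import complex.
From mathcomp Require Import zify ring.

(** The orbits are turned into double cosets of orthogonal matrices; these are
classified by induction on [l], and the resulting codes are counted.

Borel subalgebras.  By Lie's theorem ([lie_theorem]) the elements of a solvable
subalgebra of so(2l+1), [l > 0], have a common eigenvector.  It can be chosen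
isotropic ([isotropic_eigenvector]), and splitting off the hyperbolic plane that
it spans with a dual vector lowers [l] by one.  So every solvable subalgebra is
contained in a conjugate of the upper triangular subalgebra [borel0]
([solvable_sub_Ad_borel0]).  All these conjugates are solvable of the same
dimension, hence they are exactly the Borel subalgebras ([borel_so_conj]).  An
orthogonal matrix normalizing [borel0] is upper triangular
([normalizer_borel0]), because it must respect the kernels of the powers of a
regular nilpotent element.  Therefore [Ad g borel0] and [Ad h borel0] lie
in the same orbit if and only if [h = b g u] with [b] in B_SO(2l) and [u]
orthogonal and upper triangular ([Ad_orbit_eq]).

Double cosets.  The columns of [g] span an isotropic flag.  The first nonzero
position [q] of the last row of [g] is the position of the line of e_1 relative
to this flag; it can be any position but the middle one.  Right multiplication
makes the last row a coordinate vector ([equivB_last_row]); deleting then the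
first and last rows and the column [q] with its mirror image leaves an
orthogonal matrix [h] of size 2l-1, namely the flag induced on the quotient of
the orthogonal of e_1 by e_1.  Given [q] and [h], the only remaining freedom is
the column [q], and B_SO(2l) can clear all its entries except the one, [t], in
the row of e_0 ([equivB_extend]).  If an earlier column of [h] has a nonzero
entry in the row of e_0, it can be used to clear [t] as well
([equivB_extend_clear]).  Otherwise the torus rescales a nonzero [t] to 1
([equivB_extend_scale]), and the cases 0 and 1 are distinguished by the first
nonzero position of the row of e_0, called the level.  So an orbit of rank [l]
and level [d] has 2 (l + 1) + (d + 1) successors in rank [l + 1].  The codes
record these choices ([equivB_rep], [equivB_rep_inj]).  In the same way a signed
partial permutation matrix is built row by row, the level being the number of
columns before the first empty one: a new row either has a signed entry in one
of the [l + 1] possible places, or is empty and comes with a new first empty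
column, inserted in one of the [d + 1] places up to the previous one.

Counting.  The sums of 'C(level w, j) over the codes satisfy a recursion which
is closed in [l] and [j] and has an explicit solution ([sum_codes]).  For
[j = 0] it gives the number of orbits, the sum over [k] of
2^(l-k) (l-k)! 'C(l, k)^2.  Divided by l! this is the sum of
'C(l, k) 2^(l-k) / k!, the coefficient of x^l in the sum over [k] of
(1 / k!) x^k / (1 - 2x)^(k+1), which is the given series. *)

Set Implicit Arguments.
Unset Strict Implicit.
Unset Printing Implicit Defensive.

Import Order.TTheory GRing.Theory Num.Theory.
Local Open Scope ring_scope.

(** * Orthogonal matrices for the antidiagonal form *)

Section Adjoint.
Variable F : numFieldType.

(** The adjoint for the form with the antidiagonal matrix [beta]: this is
[beta A^T beta]. *)
Definition adj m n (A : 'M[F]_(m, n)) : 'M[F]_(n, m) :=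
  \matrix_(i, j) A (rev_ord j) (rev_ord i).

Lemma adjK m n (A : 'M[F]_(m, n)) : adj (adj A) = A.
Proof. by apply/matrixP => i j; rewrite !mxE !rev_ordK. Qed.

Lemma adjM m n p (A : 'M[F]_(m, n)) (B : 'M[F]_(n, p)) :
  adj (A *m B) = adj B *m adj A.
Proof.
apply/matrixP => i j; rewrite !mxE (reindex_inj rev_ord_inj) /=.
by apply: eq_bigr => k _; rewrite !mxE mulrC.
Qed.

Lemma adjD m n (A B : 'M[F]_(m, n)) : adj (A + B) = adj A + adj B.
Proof. by apply/matrixP => i j; rewrite !mxE. Qed.

Lemma adjN m n (A : 'M[F]_(m, n)) : adj (- A) = - adj A.
Proof. by apply/matrixP => i j; rewrite !mxE. Qed.

Lemma adjZ m n a (A : 'M[F]_(m, n)) : adj (a *: A) = a *: adj A.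
Proof. by apply/matrixP => i j; rewrite !mxE. Qed.

Lemma adj1 n : adj 1%:M = 1%:M :> 'M[F]_n.
Proof. by apply/matrixP => i j; rewrite !mxE eq_sym (inj_eq rev_ord_inj). Qed.

(** The full orthogonal group: the determinant is left free because -1 acts
trivially by conjugation. *)
Definition isO n (g : 'M[F]_n) : Prop := adj g *m g = 1%:M.

Lemma isO_mulV n (g : 'M[F]_n) : isO g -> g *m adj g = 1%:M.
Proof. exact: mulmx1C. Qed.

Lemma isO1 n : isO (1%:M : 'M[F]_n).
Proof. by rewrite /isO adj1 mulmx1. Qed.

Lemma isO_adj n (g : 'M[F]_n) : isO g -> isO (adj g).
Proof. by move=> /isO_mulV; rewrite /isO adjK. Qed.

Lemma isOM n (g h : 'M[F]_n) : isO g -> isO h -> isO (g *m h).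
Proof.
by move=> Og Oh; rewrite /isO adjM mulmxA -[_ *m g]mulmxA -mulmxA mulmxA Og mulmx1.
Qed.

Lemma isO_row n (g : 'M[F]_n) i j : isO g ->
  \sum_k g i k * g j (rev_ord k) = (i == rev_ord j)%:R.
Proof.
move=> /isO_mulV/matrixP/(_ i (rev_ord j)); rewrite !mxE => <-.
by apply: eq_bigr => k _; rewrite mxE rev_ordK.
Qed.

Lemma isO_col n (g : 'M[F]_n) i j : isO g ->
  \sum_k g (rev_ord k) i * g k j = (i == rev_ord j)%:R.
Proof.
move=> /matrixP/(_ (rev_ord i) j); rewrite !mxE.
rewrite -[_ i == j](inj_eq rev_ord_inj) rev_ordK => <-.
by apply: eq_bigr => k _; rewrite mxE rev_ordK.
Qed.

Definition upper n (u : 'M[F]_n) : Prop :=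
  forall i j : 'I_n, (j < i)%N -> u i j = 0.

Definition upO n (u : 'M[F]_n) : Prop := isO u /\ upper u.

Lemma upO1 n : upO (1%:M : 'M[F]_n).
Proof.
split; first exact: isO1.
by move=> i j ji; rewrite mxE; case: eqP => // ij; rewrite ij ltnn in ji.
Qed.

Lemma upperM n (u v : 'M[F]_n) :
  upper u -> upper v -> upper (u *m v).
Proof.
move=> Uu Uv i j ji; rewrite mxE big1 // => k _.
have [ki|ik] := ltnP k i; first by rewrite Uu ?mul0r.
by rewrite Uv ?mulr0 // (leq_trans ji).
Qed.

Lemma upOM n (u v : 'M[F]_n) : upO u -> upO v -> upO (u *m v).
Proof.
by move=> [Ou Uu] [Ov Uv]; split; [exact: isOM | exact: upperM].
Qed.

Lemma upO_adj n (u : 'M[F]_n) : upO u -> upO (adj u).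
Proof.
move=> [Ou Uu]; split; first exact: isO_adj.
by move=> i j ji; rewrite mxE Uu //=; have := ltn_ord i; lia.
Qed.

End Adjoint.

(** * Eichler transformations *)

Section Eichler.
Variables (F : numFieldType) (n : nat).
Implicit Types (q : 'I_n) (y : 'rV[F]_n).

(** For [y] orthogonal to the coordinate vector [q] and its mirror image, this is the
general element of the nilpotent radical of the stabilizer of an isotropic line
in the Lie algebra; it is skew for the form by construction. *)
Definition eichler_nil q y : 'M[F]_n :=
  delta_mx q 0 *m y - adj (delta_mx q (0 : 'I_1) *m y).

(** The exponential of [eichler_nil q y], whose cube is zero. *)
Definition eichler q y : 'M[F]_n :=
  let N := eichler_nil q y in 1%:M + N + 2%:R^-1 *: (N *m N).

Definition qform y : F := \sum_k y 0 k * y 0 (rev_ord k).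

(** All the products of two rank one terms vanish, except [D *m adj D], because
[y] has no entry in position [q] and the column [q] is isotropic. *)
Lemma eichler_nil2 q y : q != rev_ord q -> y 0 q = 0 ->
  eichler_nil q y *m eichler_nil q y =
  - (delta_mx q 0 *m y *m adj (delta_mx q (0 : 'I_1) *m y)) /\
  eichler_nil q y *m eichler_nil q y *m eichler_nil q y = 0.
Proof.
move=> qq yq; rewrite /eichler_nil; set D := _ *m y.
have DD : D *m D = 0.
  rewrite /D mulmxA -[_ *m y *m _]mulmxA (_ : y *m _ = 0) ?mulmx0 ?mul0mx //.
  by apply/matrixP => i j; rewrite -colE !mxE ord1 yq.
have DaD : adj D *m D = 0.
  rewrite /D adjM mulmxA -[adj y *m _ *m _]mulmxA.
  rewrite (_ : _ *m delta_mx q 0 = 0) ?mulmx0 ?mul0mx //.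
  apply/matrixP => i j; rewrite -colE !mxE.
  by rewrite eq_sym (negPf qq).
have aDaD : adj D *m adj D = 0.
  by rewrite -adjM DD; apply/matrixP => i j; rewrite !mxE.
have N2 : (D - adj D) *m (D - adj D) = - (D *m adj D).
  by rewrite mulmxBl !mulmxBr DD DaD aDaD sub0r subrr subr0.
split=> //; rewrite N2 mulNmx mulmxBr -!mulmxA DaD aDaD !mulmx0.
by rewrite subrr oppr0.
Qed.

(** The exponential of a skew matrix is orthogonal; as the cube is zero this is
an identity between polynomials of degree 2. *)
Lemma isO_eichler q y : q != rev_ord q -> y 0 q = 0 -> isO (eichler q y).
Proof.
move=> qq yq; have [_ N3] := eichler_nil2 qq yq.
rewrite /isO /eichler; have := N3; set N := eichler_nil q y => {}N3.
have aN : adj N = - N by rewrite /N adjD adjN adjK opprD opprK addrC.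
clearbody N; have N3' : N *m (N *m N) = 0 by rewrite mulmxA.
have N4 : N *m N *m (N *m N) = 0 by rewrite mulmxA N3 mul0mx.
rewrite !adjD adj1 adjZ adjM aN mulmxN mulNmx opprK.
rewrite !(mulmxDl, mulmxDr, mul1mx, mulmx1, mulNmx, mulmxN).
rewrite -!(scalemxAl, scalemxAr) N3 N3' N4 !scaler0 !addr0 oppr0 addr0.
apply/matrixP => i j; rewrite !mxE; set a := \sum_k _.
by field.
Qed.

Lemma eichlerE q y i j : q != rev_ord q -> y 0 q = 0 ->
  eichler q y i j = (i == j)%:R + (i == q)%:R * y 0 j
   - y 0 (rev_ord i) * (j == rev_ord q)%:R
   - 2%:R^-1 * qform y * (i == q)%:R * (j == rev_ord q)%:R.
Proof.
move=> qq yq; have [N2 _] := eichler_nil2 qq yq.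
rewrite /eichler N2 adjM -mulmxA [y *m _]mulmxA !mxE !big_ord1 !mxE.
rewrite !eqxx !andbT !(inv_eq (@rev_ordK _)) !big_ord1 !mxE.
have -> : \sum_k y 0 k * adj y k 0 = qform y.
  by apply: eq_bigr => k _; rewrite mxE; congr (_ * y _ _); rewrite [LHS]ord1.
rewrite [rev_ord ord0]ord1 eqxx andbT (inv_eq (@rev_ordK _)); ring.
Qed.

(** The entry in position (q, rev_ord q) is proportional to [qform y].  When it is
below the diagonal, [y] is supported on an isotropic coordinate subspace and
this entry is zero. *)
Lemma eichler_upper q y : q != rev_ord q ->
  (forall j, y 0 j != 0 -> (q < j)%N) -> upO (eichler q y).
Proof.
move=> qq yj; have yq : y 0 q = 0.
  by apply/eqP/negPn/negP => /yj; rewrite ltnn.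
split=> [|i j ji]; first exact: isO_eichler.
rewrite eichlerE // (_ : (i == j) = false) ?add0r; last first.
  by apply: contraTF ji => /eqP->; rewrite ltnn.
have -> : (i == q)%:R * y 0 j = 0.
  case: eqP => [iq|]; last by rewrite mul0r.
  rewrite mul1r; apply: contraTeq ji => /yj; rewrite iq; lia.
have -> : y 0 (rev_ord i) * (j == rev_ord q)%:R = 0.
  case: eqP => [jq|]; last by rewrite mulr0.
  rewrite mulr1; apply: contraTeq ji => /yj.
  by rewrite jq /=; have := ltn_ord i; have := ltn_ord q; lia.
rewrite !sub0r oppr0 add0r -mulrA -natrM mulnb.
case: andP => [[/eqP iq /eqP jq]|]; last by rewrite mulr0 oppr0.
rewrite /qform big1 ?mulr0 ?mul0r ?oppr0 // => k _; apply/eqP; rewrite mulf_eq0.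
apply/negPn/negP; rewrite negb_or => /andP[/yj + /yj].
move: ji; rewrite iq jq /=; have := ltn_ord k; have := ltn_ord q; lia.
Qed.

End Eichler.

(** * Removing a position and its mirror image *)

Section Skip.
Variables (n : nat).
Implicit Types (r c d : 'I_n.+2).

Lemma skip_proof r (i : 'I_n) :
  (i + (minn r (rev_ord r) <= i) + (maxn r (rev_ord r) <= i.+1) < n.+2)%N.
Proof. by have := ltn_ord i; lia. Qed.

(** The increasing enumeration of the positions other than [r] and its mirror
image; it commutes with the mirror symmetry ([rev_skip]). *)
Definition skip r i : 'I_n.+2 := Ordinal (skip_proof r i).

Lemma ltn_skip r i j : (skip r i < skip r j)%N = (i < j)%N.
Proof. rewrite /=; lia. Qed.

Lemma skip_inj r : injective (skip r).
Proof.
move=> i j ij; apply: val_inj; have := ltn_skip r i j; have := ltn_skip r j i.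
by rewrite ij ltnn /=; lia.
Qed.

Lemma rev_skip r i : rev_ord (skip r i) = skip r (rev_ord i).
Proof. apply: val_inj; case: r => r lr; case: i => i li /=; lia. Qed.

(** The middle position, of e_0, is its own mirror image; every other position
belongs to a pair, that of a hyperbolic plane. *)
Definition nmid r : bool := r != rev_ord r.

Lemma nmidE r : nmid r = (val r != n.+2 - r.+1)%N.
Proof. by []. Qed.

Lemma nmid_max : nmid ord_max.
Proof. by rewrite nmidE /= subnn. Qed.

Lemma skip_neq r i : nmid r -> (skip r i == r) = false.
Proof. rewrite nmidE -val_eqE; case: r => r lr; case: i => i li /=; lia. Qed.

Lemma skip_neq_rev r i : nmid r -> (skip r i == rev_ord r) = false.
Proof. rewrite nmidE -val_eqE; case: r => r lr; case: i => i li /=; lia. Qed.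

Variant skip_spec r : 'I_n.+2 -> Type :=
| SkipSelf : skip_spec r r
| SkipRev : skip_spec r (rev_ord r)
| SkipOther i : skip_spec r (skip r i).

Lemma skipP r j : nmid r -> skip_spec r j.
Proof.
move=> hr; have [->|jr] := eqVneq j r; first by constructor.
have [->|jrr] := eqVneq j (rev_ord r); first by constructor.
have jr' : j != r :> nat by [].
have jrr' : (j != n.+2 - r.+1 :> nat)%N by [].
have hr' : (r != n.+2 - r.+1 :> nat)%N by [].
have H : (j - (minn r (n.+2 - r.+1) <= j) - (maxn r (n.+2 - r.+1) <= j) < n)%N.
  by clear -jr' jrr' hr'; case: r j hr' jr' jrr' => r lr [j lj] /=; lia.
have -> : j = skip r (Ordinal H).
  apply: val_inj => /=.
  by move: hr' jr' jrr' => {H hr jr jrr}; case: r j => r lr [j lj] /=; lia.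
by constructor.
Qed.

Lemma sum_skip (V : nmodType) r (f : 'I_n.+2 -> V) : nmid r ->
  \sum_j f j = f r + f (rev_ord r) + \sum_i f (skip r i).
Proof.
move=> hr; rewrite (bigD1 r) //= (bigD1 (rev_ord r)) /=; last by rewrite eq_sym.
rewrite addrA; congr (_ + _).
have -> : \sum_i f (skip r i) = \sum_(j in [set skip r i | i in 'I_n]) f j.
  by rewrite big_imset //= => i j _ _ /skip_inj.
apply: eq_bigl => j; case: (skipP j hr).
- by rewrite eqxx /=; apply/esym/imsetP => -[i _ /eqP]; rewrite eq_sym skip_neq.
- rewrite eqxx andbF; apply/esym/imsetP => -[i _ /eqP].
  by rewrite eq_sym skip_neq_rev.
- by move=> i; rewrite skip_neq // skip_neq_rev // imset_f.
Qed.

Definition unskip r j : option 'I_n := [pick i | skip r i == j].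

Lemma unskip_skip r i : unskip r (skip r i) = Some i.
Proof.
rewrite /unskip; case: pickP => [j /eqP/skip_inj ->//|/(_ i)].
by rewrite eqxx.
Qed.

Lemma unskip_self r : nmid r -> unskip r r = None.
Proof.
by move=> hr; rewrite /unskip; case: pickP => // j; rewrite skip_neq.
Qed.

Lemma unskip_rev r : nmid r -> unskip r (rev_ord r) = None.
Proof.
by move=> hr; rewrite /unskip; case: pickP => // j; rewrite skip_neq_rev.
Qed.

End Skip.

(** * Inserting and deleting a hyperbolic pair *)

Section Insertion.
Variables (F : numFieldType) (n : nat).
Implicit Types (r c d : 'I_n.+2) (t s : F) (M A B : 'M[F]_n) (g : 'M[F]_n.+2).

(** Sends the hyperbolic plane of [c] to that of [r], with the torus parameter [t],
and acts by [M] between their orthogonals.  Torus elements, changes of position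
and block embeddings are all of this form, and they multiply in the expected
way ([insM]). *)
Definition ins t r c M : 'M[F]_n.+2 := \matrix_(i, j)
  if unskip r i is Some i' then
    if unskip c j is Some j' then M i' j' else 0
  else t * ((i == r) && (j == c))%:R + t^-1 * ((i == rev_ord r) && (j == rev_ord c))%:R.

Definition del r c g : 'M[F]_n := \matrix_(i, j) g (skip r i) (skip c j).

Lemma ins_self t r c M j : nmid r -> ins t r c M r j = t * (j == c)%:R.
Proof.
move=> hr; rewrite mxE unskip_self // eqxx /=; move: hr; rewrite /nmid => /negPf->.
by rewrite mulr0 addr0.
Qed.

Lemma ins_rev t r c M j :
  nmid r -> ins t r c M (rev_ord r) j = t^-1 * (j == rev_ord c)%:R.
Proof.
move=> hr; rewrite mxE unskip_rev // eqxx /= eq_sym.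
by move: hr; rewrite /nmid => /negPf->; rewrite mulr0 add0r.
Qed.

Lemma ins_skip t r c M i j : ins t r c M (skip r i) (skip c j) = M i j.
Proof. by rewrite mxE !unskip_skip. Qed.

Lemma ins_skip_self t r c M i : nmid c -> ins t r c M (skip r i) c = 0.
Proof. by move=> hc; rewrite mxE unskip_skip unskip_self. Qed.

Lemma ins_skip_rev t r c M i : nmid c -> ins t r c M (skip r i) (rev_ord c) = 0.
Proof. by move=> hc; rewrite mxE unskip_skip unskip_rev. Qed.

Lemma del_ins t r c M : del r c (ins t r c M) = M.
Proof. by apply/matrixP => i j; rewrite mxE ins_skip. Qed.

(** The two hypotheses kill the terms passing through the hyperbolic plane of [c]
in the product. *)
Lemma delM r c d (g h : 'M[F]_n.+2) : nmid c ->
  (forall j, h c (skip d j) = 0) -> (forall i, g (skip r i) (rev_ord c) = 0) ->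
  del r d (g *m h) = del r c g *m del c d h.
Proof.
move=> hc h0 g0; apply/matrixP => i j; rewrite !mxE (sum_skip _ hc).
rewrite h0 g0 mulr0 mul0r !add0r; apply: eq_bigr => k _; by rewrite !mxE.
Qed.

Lemma del1 r : del r r 1%:M = 1%:M.
Proof. by apply/matrixP => i j; rewrite !mxE (inj_eq (@skip_inj _ r)). Qed.

Lemma adj_del r c g : adj (del r c g) = del c r (adj g).
Proof. by apply/matrixP => i j; rewrite !mxE !rev_skip. Qed.

Lemma isO_del r c g : nmid r ->
  (forall j, g r (skip c j) = 0) -> isO g -> isO (del r c g).
Proof.
move=> hr g0 Og; rewrite /isO adj_del -delM ?Og ?del1 // => i.
by rewrite mxE rev_ordK rev_skip.
Qed.

Lemma adj_ins t r c M : nmid r -> nmid c ->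
  adj (ins t r c M) = ins t^-1 c r (adj M).
Proof.
move=> hr hc; apply/matrixP => i j; rewrite mxE.
case: (skipP i hc) => [||i']; case: (skipP j hr) => [||j'];
  rewrite ?rev_skip ?rev_ordK ?ins_self ?ins_rev ?ins_skip ?ins_skip_self
    ?ins_skip_rev ?invrK ?rev_ordK ?skip_neq ?skip_neq_rev ?mulr0
    ?mxE ?eqxx //.
- by move: hr hc; rewrite /nmid ![_ == rev_ord _]eq_sym => /negPf-> /negPf->; rewrite !mulr0.
- by move: hr hc; rewrite /nmid => /negPf-> /negPf->; rewrite !mulr0.
Qed.

Lemma insM t s r c d A B : nmid r -> nmid c -> nmid d ->
  ins t r c A *m ins s c d B = ins (t * s) r d (A *m B).
Proof.
move=> hr hc hd; apply/matrixP => i j; rewrite mxE (sum_skip _ hc).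
case: (skipP i hr) => [||i'].
- rewrite !ins_self // eqxx mulr1 big1 => [|k _].
    move: hc; rewrite /nmid eq_sym => /negPf ->.
    by rewrite mulr0 mul0r !addr0 mulrA.
  by rewrite !ins_self // skip_neq // mulr0 mul0r.
- rewrite !ins_rev // eqxx mulr1 big1 => [|k _].
    move: hc; rewrite /nmid => /negPf ->.
    by rewrite mulr0 mul0r add0r addr0 invfM mulrA.
  by rewrite !ins_rev // skip_neq_rev // mulr0 mul0r.
rewrite ins_skip_self // ins_skip_rev // !mul0r !add0r.
case: (skipP j hd) => [||j'].
- by rewrite ins_skip_self // big1 // => k _; rewrite ins_skip_self ?mulr0.
- by rewrite ins_skip_rev // big1 // => k _; rewrite ins_skip_rev ?mulr0.
by rewrite ins_skip mxE; apply: eq_bigr => k _; rewrite !ins_skip.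
Qed.

Lemma ins1 r : nmid r -> ins 1 r r 1%:M = 1%:M.
Proof.
move=> hr; apply/matrixP => i j; rewrite [RHS]mxE eq_sym.
case: (skipP i hr) => [||i'].
- by rewrite ins_self // mul1r.
- by rewrite ins_rev // invr1 mul1r.
case: (skipP j hr) => [||j'].
- by rewrite ins_skip_self // eq_sym skip_neq.
- by rewrite ins_skip_rev // eq_sym skip_neq_rev.
by rewrite ins_skip mxE (inj_eq (@skip_inj _ r)) eq_sym.
Qed.

Lemma isO_ins t r c M : nmid r -> nmid c -> t != 0 -> isO M -> isO (ins t r c M).
Proof.
by move=> hr hc t0 OM; rewrite /isO adj_ins // insM // mulVf // OM ins1.
Qed.

Lemma upO_ins t r M : nmid r -> t != 0 -> upO M -> upO (ins t r r M).
Proof.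
move=> hr t0 [OM UM]; split; first exact: isO_ins.
move=> i j; case: (skipP i hr) => [||i'].
- by rewrite ins_self //; case: eqP => [->|]; rewrite ?ltnn ?mulr0.
- by rewrite ins_rev //; case: eqP => [->|]; rewrite ?ltnn ?mulr0.
case: (skipP j hr) => [||j'] ji.
- by rewrite ins_skip_self.
- by rewrite ins_skip_rev.
by rewrite ins_skip UM // -(ltn_skip r).
Qed.

(** An isotropic [v] is, up to a scalar, the image of the coordinate vector [q]
under an upper triangular Eichler transformation: isotropy forces the
coordinate of [v] at the mirror image of [q].  If [q] were the middle position,
[qform v] would be the square of [v 0 q]. *)
Lemma row_normal_form (v : 'rV[F]_n.+2) q :
  qform v = 0 -> v 0 q != 0 -> (forall j : 'I_n.+2, (j < q)%N -> v 0 j = 0) ->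
  nmid q /\ exists2 u, upO u & v *m u = delta_mx 0 q.
Proof.
move=> v0 vq vj.
have hq : nmid q.
  apply: (contra_eq_neq _ v0) => qq; rewrite /qform (bigD1 q) //= -qq big1 ?addr0.
    by rewrite -expr2 expf_neq0.
  move=> k kq; have [/vj->|] := ltnP k q; first by rewrite mul0r.
  rewrite leq_eqVlt eq_sym val_eqE (negPf kq) /= => qk.
  rewrite [v 0 (rev_ord k)]vj ?mulr0 //; move: qk; rewrite /= {1}qq /=.
  have := congr1 val qq => /=; have := ltn_ord q; have := ltn_ord k; lia.
split=> //.
(* the coordinate of [v] at the mirror image of [q] is left to isotropy *)
pose y : 'rV[F]_n.+2 := \row_j if (j == q) || (j == rev_ord q) then 0
  else (v 0 q)^-1 * v 0 j.
have yq : y 0 q = 0 by rewrite mxE eqxx.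
have yrq : y 0 (rev_ord q) = 0 by rewrite mxE eqxx orbT.
have yk k : y 0 (skip q k) = (v 0 q)^-1 * v 0 (skip q k).
  by rewrite mxE skip_neq // skip_neq_rev.
pose w := ins (v 0 q) q q 1%:M *m eichler q y.
have wU : upO w.
  apply: upOM; first by apply: upO_ins => //; apply: upO1.
  apply: eichler_upper => // j; rewrite mxE; case: (j =P q) => [->|/eqP jq]; rewrite ?eqxx //=.
  case: (j =P rev_ord q); rewrite ?eqxx // => _; rewrite mulf_eq0 negb_or => /andP[_].
  by apply: contra_neqT; rewrite -leqNgt leq_eqVlt val_eqE (negPf jq) /=; apply: vj.
exists (adj w); first exact: upO_adj.
suff -> : v = delta_mx 0 q *m w.
  by rewrite -mulmxA (isO_mulV (proj1 wU)) mulmx1.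
rewrite -rowE /w; apply/rowP => j; rewrite [RHS]mxE mxE (bigD1 q) //= big1.
  2: by move=> k kq; rewrite ins_self // (negPf kq) mulr0 mul0r.
rewrite ins_self // eqxx mulr1 addr0 eichlerE // eqxx yrq mul0r subr0 mulr1 mul1r.
case: (skipP j hq) => [||k].
- by rewrite eqxx yq (negPf hq) mulr0 subr0 addr0 mulr1.
- rewrite (negPf hq) yrq eqxx !add0r mulr1.
  move: v0; rewrite /qform !(sum_skip _ hq) /= !rev_ordK yq yrq !mulr0 !add0r.
  have -> : \sum_i y 0 (skip q i) * y 0 (rev_ord (skip q i)) =
      \sum_i (v 0 q)^-1 * (v 0 q)^-1 * (v 0 (skip q i) * v 0 (rev_ord (skip q i))).
    by apply: eq_bigr => k _; rewrite rev_skip !yk mulrACA.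
  rewrite -mulr_sumr; set S := \sum_k _ => H.
  have -> : S = - (2 * v 0 q * v 0 (rev_ord q)).
    by apply/eqP; rewrite -addr_eq0 -H; apply/eqP; ring.
  by field.
by rewrite eq_sym skip_neq // add0r yk skip_neq_rev // mulr0 subr0 mulVKf.
Qed.

End Insertion.

(** * Solvable Lie algebras of matrices: Lie's theorem *)

Section LieTheorem.
Variables (C : numClosedFieldType) (n : nat).
Implicit Types (X Y h : 'M[C]_n) (U V : {vspace 'M[C]_n}).

Lemma sub_lie_commutator U V (W : {vspace 'M[C]_n}) :
  (forall X Y, X \in U -> Y \in V -> lie_bracket X Y \in W) ->
  (lie_commutator U V <= W)%VS.
Proof.
move=> UV; apply/span_subvP => _ /allpairsP[[X Y] /= [XU YV ->]].
by apply: UV; apply: vbasis_mem.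
Qed.

Lemma mem_lie_commutator U V X Y :
  X \in U -> Y \in V -> lie_bracket X Y \in lie_commutator U V.
Proof.
move=> XU YV; rewrite (coord_vbasis XU) (coord_vbasis YV) /lie_bracket.
rewrite mulmx_suml mulmx_sumr -sumrB memv_suml // => i _.
rewrite mulmx_sumr mulmx_suml -sumrB memv_suml // => j _.
rewrite -!scalemxAl -!scalemxAr !scalerA mulrC -scalerBr memvZ // memv_span //.
by apply/allpairsP; exists ((vbasis U)`_i, (vbasis V)`_j); split=> //=;
  rewrite mem_nth ?size_tuple.
Qed.

Lemma lie_subalgebra_commutator U :
  lie_subalgebra U -> lie_subalgebra (lie_commutator U U).
Proof.
move=> aU A B /(subvP (sub_lie_commutator aU)) AU.
by move=> /(subvP (sub_lie_commutator aU)) BU; apply: mem_lie_commutator.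
Qed.

(** On an invariant subspace, with basis the rows of [R], a bracket acts by a
commutator, so its trace there is zero. *)
Lemma trace_scalar_bracket m n' (R : 'M[C]_(m, n')) (A B : 'M[C]_n')
    (P Q : 'M[C]_m) (T : 'M[C]_m) :
  row_free R -> R *m A = P *m R -> R *m B = Q *m R ->
  R *m (A *m B - B *m A) = T *m R -> \tr T = 0.
Proof.
move=> fR RA RB RT.
have -> : T = P *m Q - Q *m P.
  apply: (row_free_inj fR); rewrite -RT mulmxBr mulmxBl !mulmxA RA RB.
  by rewrite -!mulmxA RA RB.
by rewrite linearB /= mxtrace_mulC subrr.
Qed.

(** The step of Lie's theorem that needs characteristic 0.  On the subspace spanned
by [w], [w X], [w X^2], ..., each [h] in the ideal [D] is triangular with all
diagonal entries equal to [lam h].  The trace of the bracket of [X] and [h] on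
this subspace is thus a nonzero multiple of [lam (lie_bracket X h)]; but it is
the trace of a commutator. *)
Lemma weight_bracket0 X (D : {vspace 'M[C]_n}) (lam : 'M[C]_n -> C)
    (w : 'rV[C]_n) :
  (forall h, h \in D -> lie_bracket X h \in D) -> w != 0 ->
  (forall h, h \in D -> w *m h = lam h *: w) ->
  forall h, h \in D -> lam (lie_bracket X h) = 0.
Proof.
move=> idD w0 wD h hD.
pose wi i := iter i (mulmxr X) w.
pose K m := \matrix_(i < m) wi i : 'M[C]_(m, n).
have wiK i m : (i < m)%N -> (wi i <= K m)%MS.
  by move=> im; rewrite -[wi i](rowK wi (Ordinal im)) row_sub.
have KE m : (K m.+1 :=: K m + wi m)%MS.
  apply/eqmxP/andP; split.
    apply/row_subP => i; rewrite rowK; have := ltn_ord i; rewrite ltnS leq_eqVlt.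
    case/orP => [/eqP->|/wiK ik]; first exact: addsmxSr.
    exact: submx_trans ik (addsmxSl _ _).
  rewrite addsmx_sub wiK // andbT; apply/row_subP => i; rewrite rowK wiK //.
  exact: leqW.
(* triangularity of the ideal on the Krylov subspace, with diagonal [lam g] *)
have wiD i g : g \in D -> (wi i *m g - lam g *: wi i <= K i)%MS.
  elim: i g => [|i IH] g gD; first by rewrite /wi /= wD // subrr sub0mx.
  have -> : wi i.+1 *m g - lam g *: wi i.+1 =
      (wi i *m g - lam g *: wi i) *m X +
      ((wi i *m lie_bracket X g - lam (lie_bracket X g) *: wi i)
        + lam (lie_bracket X g) *: wi i).
    rewrite subrK /wi /= /lie_bracket mulmxBr mulmxBl -scalemxAl !mulmxA.
    by rewrite [RHS]addrC addrA subrK.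
  rewrite addmx_sub //.
    have /submxP [u ->] := IH g gD; rewrite -mulmxA mulmx_sub //.
    apply/row_subP => j; rewrite row_mul rowK.
    by rewrite -[_ *m X]/(wi j.+1) wiK ?ltnS ?ltn_ord.
  rewrite addmx_sub //.
    by apply: submx_trans (IH _ (idD _ gD)) _; rewrite KE addsmxSl.
  by rewrite scalemx_sub ?wiK.
(* the first [m] at which the iterates become dependent *)
have [m mK mmin] : exists2 m, (wi m <= K m)%MS & row_free (K m).
  have ex : exists m, ~~ row_free (K m.+1).
    exists n; rewrite /row_free neq_ltn; apply/orP; left.
    exact: leq_ltn_trans (rank_leq_col _) _.
  pose m := ex_minn ex; exists m; rewrite /m; case: ex_minnP => {}m nf mm.
    apply/negbNE/negP => nwi; case/negP: nf.
    have fm : row_free (K m).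
      by case: (m) mm => [|k] mm; [rewrite /row_free flatmx0 mxrank0 |
        apply/negPn/negP => /mm; rewrite ltnn].
    rewrite /row_free KE.
    have /eqP := mxrank_sum_cap (K m) (wi m).
    have -> : \rank (K m :&: wi m)%MS = 0%N.
      have := mxrankS (capmxSr (K m) (wi m)); have := rank_leq_row (wi m).
      case: (ltngtP (\rank (K m :&: wi m)%MS) 0) => // pos le1 le2.
      case/negP: nwi; apply: submx_trans (capmxSl _ (wi m)).
      have r1 := leq_trans le2 le1.
      have [_ <-] := mxrank_leqif_sup (capmxSr (K m) (wi m)).
      by rewrite eqn_leq le2 (leq_trans le1).
    have -> : \rank (wi m) = 1%N.
      rewrite rank_rV; case: eqP => // E0; case/negP: nwi.
      by rewrite E0 sub0mx.
    by rewrite addn0 addn1 (eqP fm).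
  case: (m) mm => [|k] mm; first by rewrite /row_free flatmx0 mxrank0.
  by apply/negPn/negP => /mm; rewrite ltnn.
have m0 : (0 < m)%N.
  case: (m) mK => // /mxrankS; rewrite (flatmx0 (K 0%N)) mxrank0 leqn0.
  by rewrite mxrank_eq0 (negPf w0).
have [P KX] : exists P, K m *m X = P *m K m.
  apply/submxP/row_subP => i; rewrite row_mul rowK -[_ *m X]/(wi i.+1).
  have := ltn_ord i; rewrite leq_eqVlt => /orP[/eqP->//|]; exact: wiK.
have tri g : g \in D -> exists2 T, K m *m g = T *m K m & \tr T = lam g *+ m.
  move=> gD.
  have ex (i : 'I_m) : {u : 'rV_i | wi i *m g - lam g *: wi i = u *m K i}.
    by apply: sig_eqW; have /submxP[u ->] := wiD i g gD; exists u.
  pose T := \matrix_(i, j) (if insub (nat_of_ord j) is Some k then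
     sval (ex i) 0 k else (i == j)%:R * lam g).
  exists T.
    apply/row_matrixP => i; rewrite !row_mul rowK.
    rewrite -[LHS](subrK (lam g *: wi i)) (svalP (ex i)).
    rewrite [RHS]mulmx_sum_row (bigID (fun j : 'I_m => (j < i)%N)) /=; congr (_ + _).
      rewrite mulmx_sum_row.
      rewrite (big_ord_narrow (ltnW (ltn_ord i))) /=.
      apply: eq_bigr => j _; rewrite !rowK !mxE; congr (_ *: _).
      case: insubP => /= [k _ kj|]; last by rewrite ltn_ord.
      by rewrite (_ : k = j) //; apply: val_inj; exact: kj.
    rewrite (bigD1 i) /= ?ltnn // big1 => [|j /andP[ji nji]].
      rewrite addr0 rowK !mxE; case: insubP => /= [k|]; first by rewrite ltnn.
      by rewrite eqxx mul1r.
    rewrite !mxE; case: insubP => /= [k ij|]; first by rewrite ij in ji.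
    by rewrite eq_sym (negPf nji) mul0r scale0r.
  rewrite /mxtrace -[in RHS](card_ord m) -sumr_const; apply: eq_bigr => i _.
  rewrite mxE; case: insubP => /= [k|]; first by rewrite ltnn.
  by rewrite eqxx mul1r.
have [T KT _] := tri h hD; have [T' KT' tT'] := tri _ (idD _ hD).
have := trace_scalar_bracket mmin KX KT KT'.
rewrite tT' => /eqP; rewrite mulrn_eq0 => /orP[/eqP E|/eqP//].
by rewrite E in m0.
Qed.

(** Lie's theorem, for an invariant subspace.  Induction on the derived length: the
derived algebra [D] has a weight space [W'] in [W], it is stable under [U] by
[weight_bracket0], and a bracket of elements of [U] acts on it by a scalar of
trace zero.  So [U] acts on [W'] by commuting matrices, which have a common
eigenvector. *)
Theorem lie_theorem k U m (W : 'M[C]_(m, n)) :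
  lie_subalgebra U -> derived_series k U = 0%VS -> W != 0 ->
  (forall X, X \in U -> stablemx W X) ->
  exists v : 'rV[C]_n, [/\ v != 0, (v <= W)%MS &
    forall X, X \in U -> exists a, v *m X = a *: v].
Proof.
elim: k U m W => [|k IH] U m W aU; rewrite /derived_series.
  move=> /= -> W0 _; have [i wi] : exists i, row i W != 0.
    apply/existsP; move: W0; apply: contraR; rewrite negb_exists => /forallP W0.
    by apply/eqP/row_matrixP => i; rewrite row0; apply/eqP; have /negPn := W0 i.
  exists (row i W); split=> // [|X]; first exact: row_sub.
  by rewrite memv0 => /eqP ->; exists 0; rewrite mulmx0 scale0r.
rewrite iterSr -[iter k _ _]/(derived_series k _) => D0 W0 WU.
set D := lie_commutator U U in D0.
have DU : (D <= U)%VS by exact: sub_lie_commutator.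
have WD X : X \in D -> stablemx W X by move=> /(subvP DU); apply: WU.
have [v [v0 vW vD]] := IH D _ W (lie_subalgebra_commutator aU) D0 W0 WD.
have [mu muE] : {mu : 'M[C]_n -> C | forall X, X \in D -> v *m X = mu X *: v}.
  pose f X := if pselect (exists a, v *m X = a *: v) is left e then sval (cid e)
    else 0.
  exists f => X XD; rewrite /f; case: pselect => [e|]; first exact: (svalP (cid e)).
  by case; apply: vD.
pose W' := (W :&: \bigcap_(i < \dim D) eigenspace (vbasis D)`_i (mu (vbasis D)`_i))%MS.
have muL X : X \in D -> mu X = \sum_i coord (vbasis D) i X * mu (vbasis D)`_i.
  move=> XD; have := muE X XD; rewrite {1}(coord_vbasis XD) mulmx_sumr.
  under eq_bigr => i _ do rewrite -scalemxAr muE ?vbasis_mem ?mem_nth ?size_tuple // scalerA.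
  rewrite -scaler_suml => /eqP; rewrite -subr_eq0 -scalerBl scaler_eq0 (negPf v0).
  by rewrite orbF subr_eq0 => /eqP.
have W'P (w : 'rV[C]_n) :
    reflect ((w <= W)%MS /\ forall X, X \in D -> w *m X = mu X *: w) (w <= W')%MS.
  apply: (iffP idP); rewrite sub_capmx; last first.
    case=> -> wD /=; apply/sub_bigcapmxP => i _; apply/eigenspaceP.
    by rewrite wD // vbasis_mem // mem_nth ?size_tuple.
  case/andP=> -> /sub_bigcapmxP wD; split=> // X XD.
  rewrite (muL X XD) {1}(coord_vbasis XD) mulmx_sumr scaler_suml.
  apply: eq_bigr => i _; rewrite -scalemxAr -scalerA; congr (_ *: _).
  by apply/eigenspaceP; apply: wD.
have W'0 : W' != 0.
  apply: contraNneq v0 => W'0; have /W'P : (v <= W)%MS /\ forall X, X \in D -> v *m X = mu X *: v by [].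
  by rewrite W'0 submx0.
have W'U X : X \in U -> stablemx W' X.
  move=> XU; apply/row_subP => i; rewrite row_mul.
  have [->|r0] := eqVneq (row i W') 0; first by rewrite mul0mx sub0mx.
  have /W'P [rW rD] : (row i W' <= W')%MS by apply: row_sub.
  apply/W'P; split.
    by apply: submx_trans (submxMr X rW) (WU _ XU).
  move=> h hD; have idD g : g \in D -> lie_bracket X g \in D.
    by move=> gD; apply: mem_lie_commutator => //; apply: (subvP DU).
  have := rD _ (idD _ hD); rewrite (weight_bracket0 idD r0 rD hD) scale0r.
  rewrite /lie_bracket mulmxBr => /eqP; rewrite subr_eq0 !mulmxA => /eqP ->.
  by rewrite rD // scalemxAl.
pose R := row_base W'.
have fR : row_free R by exact: row_base_free.
have RW' : (R <= W')%MS by rewrite eq_row_base.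
have RU X : X \in U -> R *m X = restrictmx W' X *m R.
  move=> XU; rewrite /conjmx mulmxKpV //.
  by rewrite -/(stablemx _ _) stablemx_row_base W'U.
clearbody R.
have r0 : (0 < \rank W')%N by rewrite lt0n mxrank_eq0.
have [||u u0 /allP uU] := @common_eigenvector C _
    [seq restrictmx W' X | X <- vbasis U]; first exact: r0.
  move=> _ _ /mapP[X /vbasis_mem XU ->] /mapP[Y /vbasis_mem YU ->].
  have RXY : R *m (X *m Y - Y *m X) = (mu (lie_bracket X Y))%:M *m R.
    rewrite mul_scalar_mx; apply/row_matrixP => i; rewrite row_mul linearZ /=.
    have /W'P [_ ->//] : (row i R <= W')%MS by apply: submx_trans (row_sub _ _) RW'.
    exact: mem_lie_commutator.
  have /eqP := trace_scalar_bracket fR (RU X XU) (RU Y YU) RXY.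
  rewrite mxtrace_scalar mulrn_eq0 -leqn0 leqNgt r0 /= => /eqP mu0.
  move: (RU X XU) (RU Y YU).
  move: (restrictmx W' X) (restrictmx W' Y) => P Q RX RY.
  apply: (row_free_inj fR) => /=; apply/eqP; rewrite -subr_eq0 -!mulmxA -RX -RY.
  by rewrite !mulmxA -RX -RY -!mulmxA -mulmxBr RXY mu0 raddf0 mul0mx.
exists (u *m R); split.
- by rewrite mulmx_free_eq0.
- by rewrite mulmx_sub // (submx_trans RW') ?capmxSl.
have uR (i : 'I_(\dim U)) : (u *m R *m (vbasis U)`_i <= u *m R)%MS.
  have iU : (vbasis U)`_i \in vbasis U by rewrite mem_nth ?size_tuple.
  rewrite -mulmxA RU ?vbasis_mem // mulmxA submxMr //.
  by apply: uU; apply: map_f.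
move=> X XU; apply/sub_rVP; rewrite (coord_vbasis XU) mulmx_sumr summx_sub // => i _.
by rewrite -scalemxAr scalemx_sub.
Qed.

End LieTheorem.

(** * Images of solvable Lie algebras *)

Section LieImage.
Variables (C : numClosedFieldType) (n m : nat).
Variables (phi : 'Hom('M[C]_n, 'M[C]_m)) (U : {vspace 'M[C]_n}).
Hypothesis U_alg : lie_subalgebra U.
Hypothesis phiM : forall X Y, X \in U -> Y \in U ->
  phi (lie_bracket X Y) = lie_bracket (phi X) (phi Y).

Lemma lie_subalgebra_img : lie_subalgebra (phi @: U)%VS.
Proof.
move=> _ _ /memv_imgP[X XU ->] /memv_imgP[Y YU ->].
by rewrite -phiM // memv_img // U_alg.
Qed.

Lemma derived_series_sub k : (derived_series k U <= U)%VS.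
Proof.
elim: k => [|k IH] //=; apply: sub_lie_commutator => X Y XD YD.
by apply: U_alg; apply: (subvP IH).
Qed.

Lemma lie_solvable_img : lie_solvable U -> lie_solvable (phi @: U)%VS.
Proof.
case=> k Dk; exists k.
suff : (derived_series k (phi @: U) <= phi @: derived_series k U)%VS.
  by rewrite Dk limg0 subv0 => /eqP.
elim: k {Dk} => [|k IH]; first exact: subvv.
apply: sub_lie_commutator => X Y /(subvP IH)/memv_imgP[X' XD ->].
move=> /(subvP IH)/memv_imgP[Y' YD ->].
rewrite -phiM; [|exact: (subvP (derived_series_sub k))..].
by rewrite memv_img //; apply: mem_lie_commutator.
Qed.

End LieImage.

(** * The upper triangular subalgebra and its conjugates *)

Section StandardBorel.
Variables (C : numClosedFieldType) (n : nat).
Implicit Types (X Y g : 'M[C]_n) (U b : {vspace 'M[C]_n}).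

Definition antisym_part X := X + adj X.

Fact antisym_part_linear : linear antisym_part.
Proof.
by move=> a X Y; rewrite /antisym_part adjD adjZ scalerDr addrACA.
Qed.
HB.instance Definition _ :=
  GRing.isLinear.Build C 'M[C]_n 'M[C]_n _ antisym_part antisym_part_linear.

Definition below_band k X : 'M[C]_n := \matrix_(i, j) (X i j *+ (j < i + k)%N).

Fact below_band_linear k : linear (below_band k).
Proof. by move=> a X Y; apply/matrixP => i j; rewrite !mxE mulrnDl mulrnAr. Qed.
HB.instance Definition _ k :=
  GRing.isLinear.Build C 'M[C]_n 'M[C]_n _ (below_band k) (below_band_linear k).

(** The matrices that vanish below the [k]-th diagonal above the main one. *)
Definition band k : {vspace 'M[C]_n} := lker (linfun (below_band k)).

Lemma bandP k X :
  reflect (forall i j : 'I_n, (j < i + k)%N -> X i j = 0) (X \in band k).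
Proof.
rewrite memv_ker lfunE /=; apply: (iffP eqP) => [X0 i j ji|X0].
  by move/matrixP/(_ i j): X0; rewrite !mxE ji.
apply/matrixP => i j; rewrite !mxE.
by case: (ltnP j (i + k)) => [/X0->|]; rewrite ?mul0rn ?mulr0n.
Qed.

Lemma band_eq0 : band n = 0%VS.
Proof.
apply/eqP; rewrite -subv0; apply/subvP => X /bandP X0; rewrite memv0.
by apply/eqP/matrixP => i j; rewrite X0 ?mxE // ltn_addl.
Qed.

Lemma band_mul (a b : nat) X Y : X \in band a -> Y \in band b -> X *m Y \in band (a + b).
Proof.
move=> /bandP X0 /bandP Y0; apply/bandP => i j ji; rewrite mxE big1 // => k _.
have [ki|ik] := ltnP k (i + a); first by rewrite X0 ?mul0r.
by rewrite Y0 ?mulr0 // (leq_trans ji) // addnA leq_add2r.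
Qed.

Lemma band_le (a b : nat) : (a <= b)%N -> (band b <= band a)%VS.
Proof.
move=> ab; apply/subvP => X /bandP X0; apply/bandP => i j ji.
by rewrite X0 // (leq_trans ji) // leq_add2l.
Qed.

Lemma band0_mul_diag X Y i :
  X \in band 0 -> Y \in band 0 -> (X *m Y) i i = X i i * Y i i.
Proof.
move=> /bandP XB /bandP YB; rewrite mxE (bigD1 i) //= big1 ?addr0 // => k.
rewrite -val_eqE neq_ltn => /orP[ki|ik]; first by rewrite XB ?mul0r ?addn0.
by rewrite YB ?mulr0 ?addn0.
Qed.

Lemma band0_bracket X Y : X \in band 0 -> Y \in band 0 -> lie_bracket X Y \in band 1.
Proof.
move=> XB YB; apply/bandP => i j; rewrite addn1 ltnS leq_eqVlt => /orP[|ji].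
  move=> /eqP/val_inj ->; rewrite mxE [X in _ + X]mxE !band0_mul_diag //.
  by rewrite mulrC subrr.
have /bandP -> // : lie_bracket X Y \in band 0.
  by rewrite rpredB // -[0%N]addn0; apply: band_mul.
by rewrite addn0.
Qed.

Definition borel0 : {vspace 'M[C]_n} := (lker (linfun antisym_part) :&: band 0)%VS.

Lemma borel0P X : reflect (adj X = - X /\ upper X) (X \in borel0).
Proof.
rewrite memv_cap memv_ker lfunE /= /antisym_part addrC addr_eq0.
apply: (iffP andP) => [[/eqP aX uX]|[aX uX]].
  by split=> // i j ji; apply: (bandP _ _ uX); rewrite addn0.
split; first exact/eqP.
by apply/bandP => i j; rewrite addn0; apply: uX.
Qed.

Lemma adj_bracket X Y : adj X = - X -> adj Y = - Y ->
  adj (lie_bracket X Y) = - lie_bracket X Y.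
Proof.
move=> aX aY; rewrite /lie_bracket adjD adjN !adjM aX aY.
by rewrite !mulNmx !mulmxN !opprK opprB.
Qed.

Lemma lie_subalgebra_borel0 : lie_subalgebra borel0.
Proof.
move=> X Y /borel0P[aX uX] /borel0P[aY uY]; apply/borel0P; split.
  exact: adj_bracket.
by move=> i j ji; rewrite mxE (upperM uX uY ji) mxE (upperM uY uX ji) subrr.
Qed.

(** Brackets of upper triangular matrices have a zero diagonal, and from then on
the bandwidth at least grows by one at each step of the derived series. *)
Lemma lie_solvable_borel0 : lie_solvable borel0.
Proof.
suff D k : (derived_series k.+1 borel0 <= band k.+1)%VS.
  by exists n.+1; apply/eqP; rewrite -subv0 -band_eq0 (subv_trans (D n)) // band_le.
elim: k => [|k IH].
  apply: sub_lie_commutator => X Y; rewrite !memv_cap => /andP[_ ?] /andP[_ ?].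
  exact: band0_bracket.
apply: sub_lie_commutator => X Y /(subvP IH) XB /(subvP IH) YB.
apply: (subvP (band_le (_ : k.+2 <= k.+1 + k.+1)%N)); first lia.
by rewrite rpredB //; apply: band_mul.
Qed.

Lemma isO_inv g : isO g -> invmx g = adj g.
Proof.
move=> Og; have [_ gu] := mulmx1_unit Og.
by rewrite -[LHS]mul1mx -Og mulmxK.
Qed.

Lemma mem_Ad g b X : isO g -> (X \in Ad g b) = (adj g *m X *m g \in b).
Proof.
move=> Og; apply/memv_imgP/idP => [[Y Yb ->]|Xb].
  rewrite lfunE /= isO_inv // !mulmxA Og mul1mx -mulmxA Og mulmx1.
  exact: Yb.
exists (adj g *m X *m g) => //; rewrite lfunE /= isO_inv //.
by rewrite !mulmxA (isO_mulV Og) mul1mx -mulmxA (isO_mulV Og) mulmx1.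
Qed.

Lemma AdM g h b : isO g -> isO h -> Ad (g *m h) b = Ad g (Ad h b).
Proof.
move=> Og Oh; apply/vspaceP => X; rewrite !mem_Ad //; last exact: isOM.
by rewrite adjM !mulmxA.
Qed.

Lemma Ad1 b : Ad 1%:M b = b.
Proof.
by apply/vspaceP => X; rewrite mem_Ad ?adj1 ?mul1mx ?mulmx1 //; apply: isO1.
Qed.

Lemma AdK g b : isO g -> Ad (adj g) (Ad g b) = b.
Proof. by move=> Og; rewrite -AdM ?Og ?Ad1 //; apply: isO_adj. Qed.

Lemma dim_Ad g b : isO g -> \dim (Ad g b) = \dim b.
Proof.
have le h c : (\dim (Ad h c) <= \dim c)%N.
  by rewrite -(limg_ker_dim (linfun (mulmxr (invmx h) \o mulmx h)) c) leq_addl.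
by move=> Og; apply/eqP; rewrite eqn_leq le -{1}(AdK b Og) le.
Qed.

Lemma adj_conj g X : adj X = - X -> adj (adj g *m X *m g) = - (adj g *m X *m g).
Proof. by move=> aX; rewrite !adjM adjK aX mulNmx mulmxN mulmxA. Qed.

Lemma solvable_subalgebra_Ad_borel0 g : isO g ->
  solvable_subalgebra (fun X => adj X = - X) (Ad g borel0).
Proof.
move=> Og; have phiM X Y : X \in borel0 -> Y \in borel0 ->
    linfun (mulmxr (invmx g) \o mulmx g) (lie_bracket X Y) =
    lie_bracket (linfun (mulmxr (invmx g) \o mulmx g) X)
                (linfun (mulmxr (invmx g) \o mulmx g) Y).
  move=> _ _; have cM A B : (g *m A *m adj g) *m (g *m B *m adj g) = g *m (A *m B) *m adj g.
    by rewrite !mulmxA -[_ *m adj g *m g]mulmxA Og mulmx1.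
  rewrite !lfunE /= isO_inv // /lie_bracket !cM mulmxBr mulmxBl.
  by [].
split.
- move=> X; rewrite mem_Ad // => /borel0P[aX _].
  have := adj_conj (adj g) aX; rewrite adjK.
  by rewrite !mulmxA (isO_mulV Og) mul1mx -mulmxA (isO_mulV Og) mulmx1.
- by apply: lie_subalgebra_img phiM; apply: lie_subalgebra_borel0.
- by apply: lie_solvable_img phiM _; [apply: lie_subalgebra_borel0 |
    apply: lie_solvable_borel0].
Qed.

End StandardBorel.

(** * Isotropic common eigenvectors *)

Section IsotropicEigenvector.
Variables (C : numClosedFieldType) (n : nat).
Implicit Types (v w : 'rV[C]_n.+2) (U : {vspace 'M[C]_n.+2}).

Lemma qformE m (v : 'rV[C]_m) : qform v = (v *m adj v) 0 0.
Proof. by rewrite mxE; apply: eq_bigr => k _; rewrite mxE [rev_ord 0]ord1. Qed.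

(** If the common eigenvector [v] is not isotropic, its weight is zero since the
elements of [U] are skew, and the orthogonal of [v] is stable under [U].  A
second eigenvector [w], taken there, is either isotropic or also of weight zero,
and then some [w + d v] is isotropic and killed by [U]. *)
Lemma isotropic_eigenvector U :
  solvable_subalgebra (fun X => adj X = - X) U ->
  exists v, [/\ v != 0, qform v = 0 & forall X, X \in U -> exists a, v *m X = a *: v].
Proof.
case=> aU algU [k Dk].
have weight0 v X a : adj X = - X -> qform v != 0 -> v *m X = a *: v -> a = 0.
  move=> aX qv vX.
  have Xv : X *m adj v = - (a *: adj v).
    by rewrite -adjZ -vX adjM aX mulNmx opprK.
  have : v *m X *m adj v = v *m (X *m adj v) by rewrite mulmxA.
  rewrite vX Xv mulmxN -scalemxAl -scalemxAr => /eqP; rewrite -addr_eq0.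
  rewrite -mulr2n => /eqP/matrixP/(_ 0 0).
  rewrite mulmxnE mxE -qformE mxE -mulr_natr.
  by move/eqP; rewrite !mulf_eq0 (negPf qv) orbF pnatr_eq0 orbF => /eqP.
have [||v [v0 _ vU]] := lie_theorem (W := 1%:M) algU Dk.
- by apply/eqP => /matrixP/(_ 0 0)/eqP; rewrite !mxE eqxx oner_eq0.
- by move=> X _; rewrite submx1.
have [qv|qv] := eqVneq (qform v) 0; first by exists v.
have vU0 X : X \in U -> v *m X = 0.
  move=> XU; have [a vX] := vU X XU.
  by rewrite vX (weight0 _ _ _ (aU X XU) qv vX) scale0r.
have [||w [w0 wK wU]] := lie_theorem (W := kermx (adj v)) algU Dk.
- rewrite -mxrank_eq0 mxrank_ker -lt0n subn_gt0.
  exact: leq_ltn_trans (rank_leq_col _) _.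
- move=> X XU; apply/sub_kermxP; rewrite -mulmxA.
  have -> : X *m adj v = 0.
    apply: (can_inj (@adjK _ _ _)); rewrite adjM adjK (aU X XU) mulmxN vU0 //.
    by apply/matrixP => i j; rewrite !mxE oppr0.
  by rewrite mulmx0.
have [qw|qw] := eqVneq (qform w) 0; first by exists w.
have wU0 X : X \in U -> w *m X = 0.
  move=> XU; have [a wX] := wU X XU.
  by rewrite wX (weight0 _ _ _ (aU X XU) qw wX) scale0r.
(* [d] makes [w + d v] isotropic, as [v] and [w] are orthogonal *)
pose d := sqrtC (- qform w / qform v).
have wv : w *m adj v = 0 by apply/sub_kermxP.
have vw : v *m adj w = 0.
  apply: (can_inj (@adjK _ _ _)); rewrite adjM adjK wv.
  by apply/matrixP => i j; rewrite !mxE.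
have qz : qform (w + d *: v) = 0.
  rewrite qformE adjD adjZ mulmxDl !mulmxDr -!scalemxAl -!scalemxAr wv vw.
  rewrite !scaler0 addr0 add0r scalerA -expr2 sqrtCK mxE [X in _ + X]mxE.
  by rewrite -!qformE divfK // subrr.
exists (w + d *: v); split=> // [|X XU].
  apply: contraNneq qw => z0; rewrite qformE.
  have := congr1 (mulmxr (adj w)) z0; rewrite /= mulmxDl -scalemxAl vw scaler0 addr0.
  by move=> ->; rewrite mul0mx mxE.
by exists 0; rewrite scale0r mulmxDl -scalemxAl vU0 // wU0 // scaler0 addr0.
Qed.

End IsotropicEigenvector.

(** * Borel subalgebras of so(2l+1) *)

Section Conjugacy.
Variable C : numClosedFieldType.

(** The action of the conjugate of [X] on the orthogonal of the last isotropic line,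
modulo this line. *)
Definition del_last n (g X : 'M[C]_n.+2) : 'M[C]_n :=
  del ord_max ord_max (adj g *m X *m g).

Fact del_last_linear n (g : 'M[C]_n.+2) : linear (del_last g).
Proof.
move=> a X Y; rewrite /del_last mulmxDr mulmxDl -scalemxAr -scalemxAl.
by apply/matrixP => i j; rewrite !mxE.
Qed.
HB.instance Definition _ n (g : 'M[C]_n.+2) :=
  GRing.isLinear.Build C 'M[C]_n.+2 'M[C]_n _ (del_last g) (del_last_linear g).

(** Since [X] is skew, the condition on the last row also clears the first column. *)
Lemma upper_of_del n (X : 'M[C]_n.+2) a : adj X = - X ->
  row ord_max X = a *: delta_mx 0 ord_max ->
  upper (del ord_max ord_max X) -> upper X.
Proof.
move=> aX rX uX i j; have hm := nmid_max n.
have r0 k : k != ord_max -> X ord_max k = 0.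
  move=> kn; have /rowP/(_ k) := rX; rewrite !mxE (negPf kn) mulr0.
  by [].
have c0 k : k != rev_ord ord_max -> X k (rev_ord ord_max) = 0.
  move=> kn; have /matrixP/(_ k (rev_ord ord_max)) := aX; rewrite !mxE rev_ordK.
  rewrite r0; first by move/eqP; rewrite eq_sym oppr_eq0 => /eqP.
  by rewrite -[ord_max]rev_ordK (inj_eq rev_ord_inj).
case: (skipP i hm) => [||i'] ji.
- by rewrite r0 //; apply: contraTneq ji => ->; rewrite ltnn.
- by move: ji; rewrite /= subnn.
case: (skipP j hm) ji => [||j'] ji.
- by move: ji; rewrite ltnNge -ltnS ltn_ord.
- by rewrite c0 // skip_neq_rev.
by have := uX i' j'; rewrite mxE; apply; rewrite ltn_skip in ji.
Qed.

Lemma isotropic_to_last n (v : 'rV[C]_n.+2) : v != 0 -> qform v = 0 ->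
  exists2 g : 'M[C]_n.+2, isO g & v *m g = delta_mx 0 ord_max.
Proof.
move=> v0 qv.
have [q0 vq0] : exists q, v 0 q != 0.
  by apply/existsP; apply: contraNT v0; rewrite negb_exists => /forallP v0;
    apply/eqP/rowP => j; rewrite mxE; apply/eqP; move: (v0 j); rewrite negbK.
case: (@arg_minnP _ q0 (fun q => v 0 q != 0) val vq0) => q vq qmin.
have [|hq [u [Ou _] vu]] := row_normal_form qv vq.
  by move=> j jq; apply: contraTeq jq => /qmin; rewrite -leqNgt.
exists (u *m ins 1 q ord_max 1%:M).
  apply: isOM => //; apply: isO_ins => //; rewrite ?oner_eq0 ?nmid_max //.
  exact: isO1.
rewrite mulmxA vu -rowE; apply/rowP => j.
by rewrite mxE ins_self ?nmid_max // mul1r mxE eqxx.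
Qed.

(** Conjugate so that the isotropic common eigenvector is the last coordinate vector;
deleting the outer rows and columns is then a morphism of Lie algebras on [U],
to which the hypothesis in size [n] applies. *)
Lemma solvable_sub_Ad_borel0_step n :
  (forall U : {vspace 'M[C]_n}, solvable_subalgebra (fun X => adj X = - X) U ->
    exists2 g, isO g & (U <= Ad g (borel0 C n))%VS) ->
  forall U : {vspace 'M[C]_n.+2}, solvable_subalgebra (fun X => adj X = - X) U ->
    exists2 g, isO g & (U <= Ad g (borel0 C n.+2))%VS.
Proof.
move=> IH U sU.
have [v [v0 qv vU]] := isotropic_eigenvector sU.
have [g Og vg] := isotropic_to_last v0 qv.
have hm := nmid_max n.
case: sU => aU algU solU.
have rowg X : X \in U -> exists a, row ord_max (adj g *m X *m g) = a *: delta_mx 0 ord_max.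
  move=> XU; have [a vX] := vU X XU; exists a.
  rewrite rowE -vg !mulmxA -[_ *m g *m adj g]mulmxA (isO_mulV Og) mulmx1 vX.
  by rewrite scalemxAl.
have ag X : X \in U -> adj (adj g *m X *m g) = - (adj g *m X *m g).
  by move=> XU; apply: adj_conj; apply: aU.
have r0 X : X \in U -> forall j, (adj g *m X *m g) ord_max (skip ord_max j) = 0.
  move=> XU j; have [a /rowP/(_ (skip ord_max j))] := rowg X XU.
  by rewrite mxE => ->; rewrite !mxE skip_neq // mulr0.
have c0 X : X \in U -> forall i, (adj g *m X *m g) (skip ord_max i) (rev_ord ord_max) = 0.
  move=> XU i; have /matrixP/(_ (skip ord_max i) (rev_ord ord_max)) := ag X XU.
  rewrite mxE rev_ordK rev_skip r0 // mxE => /eqP.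
  by rewrite eq_sym oppr_eq0 => /eqP.
have gM X Y : adj g *m (X *m Y) *m g = (adj g *m X *m g) *m (adj g *m Y *m g).
  by rewrite !mulmxA -[_ *m g *m adj g]mulmxA (isO_mulV Og) mulmx1.
have phiM X Y : X \in U -> Y \in U -> linfun (del_last g) (lie_bracket X Y) =
    lie_bracket (linfun (del_last g) X) (linfun (del_last g) Y).
  move=> XU YU; rewrite !lfunE /= linearB /= /del_last !gM.
  by rewrite (delM hm (r0 _ YU) (c0 _ XU)) (delM hm (r0 _ XU) (c0 _ YU)).
have [|h Oh hU] := IH (linfun (del_last g) @: U)%VS.
  split.
  - move=> _ /memv_imgP[X XU ->]; rewrite lfunE /= /del_last adj_del ag //.
    by apply/matrixP => i j; rewrite !mxE.
  - exact: lie_subalgebra_img phiM.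
  - exact: lie_solvable_img phiM _.
pose h' := ins 1 ord_max ord_max h.
have Oh' : isO h' by apply: isO_ins => //; rewrite ?oner_eq0.
exists (g *m h'); first exact: isOM.
apply/subvP => X XU; rewrite mem_Ad; last exact: isOM.
have -> : adj (g *m h') *m X *m (g *m h') = adj h' *m (adj g *m X *m g) *m h'.
  by rewrite adjM !mulmxA.
have aX' := adj_conj h' (ag X XU).
apply/borel0P; split=> //.
have [a rX] := rowg X XU.
have adjh' : adj h' = ins 1 ord_max ord_max (adj h) by rewrite adj_ins // invr1.
apply: (upper_of_del (a := a)) => //.
  rewrite adjh' row_mul row_mul.
  have -> : row ord_max (ins 1 ord_max ord_max (adj h)) = delta_mx 0 ord_max.
    by apply/rowP => j; rewrite mxE ins_self // mul1r mxE eqxx.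
  rewrite -rowE rX -scalemxAl -rowE; congr (_ *: _).
  by apply/rowP => j; rewrite mxE ins_self // mul1r mxE eqxx.
rewrite (delM hm); first last.
- move=> i; rewrite adjh' mxE (sum_skip _ hm) big1.
    by rewrite ins_skip_self // ins_skip_rev // !mul0r !addr0.
  by move=> k _; rewrite c0 ?mulr0.
- by move=> j; rewrite ins_self // skip_neq // mulr0.
rewrite (delM hm); first last.
- by move=> i; rewrite adjh' ins_skip_rev.
- exact: r0.
rewrite adjh' !del_ins.
have /(subvP hU) : linfun (del_last g) X \in (linfun (del_last g) @: U)%VS.
  exact: memv_img.
by rewrite mem_Ad // lfunE /= => /borel0P[].
Qed.

Theorem solvable_sub_Ad_borel0 l (U : {vspace 'M[C]_(l.*2.+1)}) :
  solvable_subalgebra (fun X => adj X = - X) U ->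
  exists2 g, isO g & (U <= Ad g (borel0 C _))%VS.
Proof.
elim: l U => [|l IH] U sU; last exact: solvable_sub_Ad_borel0_step IH U sU.
exists 1%:M; first exact: isO1.
rewrite Ad1; apply/subvP => X XU; apply/borel0P; split.
  by case: sU => + _ _; apply.
by move=> i j; rewrite (ord1 i) (ord1 j).
Qed.

Lemma in_soP l (X : 'M[C]_(l.*2.+1)) : in_so X <-> adj X = - X.
Proof.
have E i j : (X^T *m beta C l + beta C l *m X) (rev_ord i) j = adj X i j + X i j.
  rewrite mxE [X in X + _]mxE [X in _ + X]mxE (bigD1 (rev_ord j)) //= big1 => [|k kj].
    rewrite (bigD1 i) //= big1 => [|k ki].
      by rewrite !addr0 !betaE !rev_ordK !eqxx mulr1 mul1r mxE mxE.
    by rewrite betaE rev_ordK (negPf ki) mul0r.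
  by rewrite betaE -(inj_eq rev_ord_inj) rev_ordK eq_sym (negPf kj) mulr0.
split=> [X0|aX]; apply/matrixP => i j.
  by apply/eqP; rewrite [X in _ == X]mxE -addr_eq0 -E X0 mxE.
by rewrite -(rev_ordK i) E aX !mxE addNr.
Qed.

Lemma in_OP l (g : 'M[C]_(l.*2.+1)) : g^T *m beta C l *m g = beta C l <-> isO g.
Proof.
have E i j : (g^T *m beta C l *m g) (rev_ord i) j = (adj g *m g) i j.
  rewrite !mxE; apply: eq_bigr => k _; congr (_ * _).
  rewrite mxE (bigD1 (rev_ord k)) //= big1 => [|m mk].
    by rewrite betaE rev_ordK eqxx mulr1 addr0 !mxE.
  by rewrite betaE -(inj_eq rev_ord_inj) rev_ordK eq_sym (negPf mk) mulr0.
split=> [Og|Og]; apply/matrixP => i j.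
  by rewrite -E Og betaE rev_ordK mxE eq_sym.
by rewrite -(rev_ordK i) E Og betaE rev_ordK mxE eq_sym.
Qed.

Lemma solvable_subalgebra_so l (U : {vspace 'M[C]_(l.*2.+1)}) :
  solvable_subalgebra (@in_so C l) U <->
  solvable_subalgebra (fun X => adj X = - X) U.
Proof.
by split=> -[aU ? ?]; split=> // X /aU /in_soP.
Qed.

(** A solvable algebra above [Ad g borel0] lies in some [Ad h borel0], of the same
dimension. *)
Theorem borel_so_conj l (b : {vspace 'M[C]_(l.*2.+1)}) :
  borel_subalgebra (@in_so C l) b <-> exists2 g, isO g & b = Ad g (borel0 C _).
Proof.
split=> [[/solvable_subalgebra_so sb bmax]|[g Og ->]].
  have [g Og bg] := solvable_sub_Ad_borel0 sb; exists g => //; apply/esym.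
  by apply: bmax => //; apply/solvable_subalgebra_so/solvable_subalgebra_Ad_borel0.
split; first exact/solvable_subalgebra_so/solvable_subalgebra_Ad_borel0.
move=> U /solvable_subalgebra_so/solvable_sub_Ad_borel0[h Oh Uh] gU.
have gh := subv_trans gU Uh.
have E : Ad g (borel0 C _) = Ad h (borel0 C _).
  by apply/eqP; rewrite eqEdim gh !dim_Ad //=.
by apply/eqP; rewrite eqEsubv gU E Uh.
Qed.

Definition grading l : 'M[C]_(l.*2.+1) :=
  \matrix_(i, j) ((i == j)%:R * (l%:R - i%:R)).

Definition regular_nilpotent l : 'M[C]_(l.*2.+1) :=
  \matrix_(i, j) ((j == i.+1 :> nat)%:R * (-1) ^+ (l <= i)).

Lemma grading_borel0 l : grading l \in borel0 C (l.*2.+1).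
Proof.
apply/borel0P; split=> [|i j ji]; last first.
  by rewrite mxE; case: eqP => [E|]; rewrite ?mul0r //; rewrite E ltnn in ji.
apply/matrixP => i j; rewrite !mxE (inj_eq rev_ord_inj) eq_sym.
case: eqP => [->|]; rewrite ?mul0r ?oppr0 // !mul1r /= subSS.
rewrite natrB; last by have := ltn_ord j; lia.
have -> : l.*2%:R = l%:R + l%:R :> C by rewrite -natrD addnn.
ring.
Qed.

Lemma regular_nilpotent_borel0 l : regular_nilpotent l \in borel0 C (l.*2.+1).
Proof.
apply/borel0P; split=> [|i j ji]; last first.
  by rewrite mxE (_ : _ == _ = false) ?mul0r //; lia.
apply/matrixP => i j; rewrite !mxE /= !subSS.
have -> : (l.*2 - i == (l.*2 - j).+1)%N = (j == i.+1 :> nat)%N.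
  by have := ltn_ord i; have := ltn_ord j; lia.
case: (j =P i.+1 :> nat) => [ji|]; rewrite ?mul0r ?oppr0 // !mul1r.
have -> : (l <= l.*2 - j)%N = ~~ (l <= i)%N by have := ltn_ord j; lia.
by case: (l <= i)%N; rewrite /= ?expr1 ?expr0 ?opprK.
Qed.

(** This exhibits the regular nilpotent element as a bracket in [borel0], so that
each of its conjugates inside [borel0] is strictly upper triangular. *)
Lemma grading_nilpotent l :
  lie_bracket (grading l) (regular_nilpotent l) = regular_nilpotent l.
Proof.
have dl i j (X : 'M[C]_(l.*2.+1)) : (grading l *m X) i j = (l%:R - i%:R) * X i j.
  rewrite mxE (bigD1 i) //= big1 => [|k ki]; first by rewrite mxE eqxx mul1r addr0.
  by rewrite mxE eq_sym (negPf ki) !mul0r.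
have dr i j (X : 'M[C]_(l.*2.+1)) : (X *m grading l) i j = (l%:R - j%:R) * X i j.
  rewrite mxE (bigD1 j) //= big1 => [|k ki].
    by rewrite mxE eqxx mul1r addr0 mulrC.
  by rewrite mxE (negPf ki) mul0r mulr0.
apply/matrixP => i j; rewrite mxE [X in _ + X]mxE dl dr -mulrBl mxE.
case: (j =P i.+1 :> nat) => [->|]; rewrite ?mul0r ?mulr0 // mul1r.
by rewrite -natr1; ring.
Qed.

(** Let [N' = g N g^-1], strictly upper triangular.  Comparing row [i] of [N' g] and
of [g N] shifts the zeros of the rows of [g] below row [i] one step to the left,
which gives the zeros of row [i]. *)
Lemma normalizer_borel0 l (g : 'M[C]_(l.*2.+1)) :
  isO g -> Ad g (borel0 C _) = borel0 C _ -> upper g.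
Proof.
move=> Og nb.
have conjP X : X \in borel0 C _ -> g *m X *m adj g \in borel0 C _.
  move=> Xb; rewrite -nb mem_Ad // !mulmxA Og mul1mx -mulmxA Og mulmx1.
  by [].
set N := regular_nilpotent l; pose N' := g *m N *m adj g.
have N'0 (i k : 'I_(l.*2.+1)) : (k <= i)%N -> N' i k = 0.
  move=> ki; have cM A B : (g *m A *m adj g) *m (g *m B *m adj g) = g *m (A *m B) *m adj g.
    by rewrite !mulmxA -[_ *m adj g *m g]mulmxA Og mulmx1.
  have : lie_bracket (g *m grading l *m adj g) N' \in band C _ 1.
    apply: band0_bracket; [have := conjP _ (grading_borel0 l) |
      have := conjP _ (regular_nilpotent_borel0 l)]; by rewrite memv_cap => /andP[].
  have -> : lie_bracket (g *m grading l *m adj g) N' = N'.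
    rewrite /N' /lie_bracket !cM -mulmxBl -mulmxBr.
    by rewrite -/(lie_bracket _ _) grading_nilpotent.
  by move=> /bandP; apply; rewrite addn1 ltnS.
have gN : N' *m g = g *m N by rewrite /N' -mulmxA Og mulmx1.
suff S k (i j : 'I_(l.*2.+1)) : (l.*2.+1 - i <= k)%N -> (j < i)%N -> g i j = 0.
  by move=> i j; apply: (S (l.*2.+1 - i)%N).
elim: k i j => [|k IH] i j ik ji; first by have := ltn_ord i; lia.
have j1 : (j.+1 < l.*2.+1)%N by have := ltn_ord i; lia.
have /matrixP/(_ i (Ordinal j1)) := gN; rewrite mxE big1 => [|m _].
  rewrite mxE (bigD1 j) //= big1 => [|m mj].
    rewrite mxE eqxx mul1r addr0 => /esym/eqP; rewrite mulf_eq0 => /orP[/eqP//|].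
    by rewrite expf_eq0 oppr_eq0 oner_eq0 andbF.
  by rewrite mxE /= eqSS eq_sym val_eqE (negPf mj) mul0r mulr0.
have [mi|im] := leqP m i; first by rewrite N'0 ?mul0r.
by rewrite IH ?mulr0 //=; lia.
Qed.

End Conjugacy.

(** * Double cosets of orthogonal matrices *)

Section Equivalence.
Variables (F : numFieldType) (n : nat) (o : 'I_n).
Hypothesis rev_o : rev_ord o = o.
Implicit Types (b g h u : 'M[F]_n).

(** For [o] the position of e_0 this is B_SO(2l); see [in_B_SO_evenP]. *)
Definition upO_fix b : Prop := upO b /\ forall i, b i o = (i == o)%:R.

Lemma upO_fix1 : upO_fix 1%:M.
Proof. by split=> [|i]; [exact: upO1 | rewrite mxE]. Qed.

Lemma upO_fixM b b' : upO_fix b -> upO_fix b' -> upO_fix (b *m b').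
Proof.
move=> [Ub bo] [Ub' bo']; split=> [|i]; first exact: upOM.
rewrite mxE (bigD1 o) //= big1 => [|k ko]; rewrite bo'.
  by rewrite eqxx mulr1 addr0 bo.
by rewrite (negPf ko) mulr0.
Qed.

Lemma upO_fix_adj b : upO_fix b -> upO_fix (adj b).
Proof.
move=> [Ub bo]; split=> [|i]; first exact: upO_adj.
have /matrixP/(_ i o) := proj1 Ub; rewrite !mxE (bigD1 o) //= big1 => [|k ko].
  by rewrite bo eqxx mulr1 addr0 mxE.
by rewrite bo (negPf ko) mulr0.
Qed.

Lemma upO_fix_row b j : upO_fix b -> b o j = (j == o)%:R.
Proof.
move=> /upO_fix_adj[_ /(_ (rev_ord j))]; rewrite mxE rev_o rev_ordK => ->.
by rewrite -(inj_eq rev_ord_inj) rev_ordK rev_o.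
Qed.

Definition equivB g h : Prop :=
  exists b u, [/\ upO_fix b, upO u & h = b *m g *m u].

Lemma equivB_refl g : equivB g g.
Proof.
exists 1%:M, 1%:M; rewrite mul1mx mulmx1; split=> //.
  exact: upO_fix1.
exact: upO1.
Qed.

Lemma equivB_trans g h k : equivB g h -> equivB h k -> equivB g k.
Proof.
move=> [b [u [Bb Uu ->]]] [b' [u' [Bb' Uu' ->]]]; exists (b' *m b), (u *m u').
by split; [exact: upO_fixM | exact: upOM | rewrite !mulmxA].
Qed.

Lemma equivB_isO g h : equivB g h -> isO g -> isO h.
Proof.
by move=> [b [u [[[Ob _] _] [Ou _] ->]]] Og; apply: isOM => //; apply: isOM.
Qed.

Lemma equivB_left b g : upO_fix b -> equivB g (b *m g).
Proof. by move=> Bb; exists b, 1%:M; rewrite mulmx1; split=> //; apply: upO1. Qed.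

Lemma equivB_right u g : upO u -> equivB g (g *m u).
Proof.
by move=> Uu; exists 1%:M, u; rewrite mul1mx; split=> //; apply: upO_fix1.
Qed.

Definition lead (v : 'rV[F]_n) (d : nat) : Prop :=
  (exists2 j : 'I_n, j = d :> nat & v 0 j != 0) /\
  forall j : 'I_n, (j < d)%N -> v 0 j = 0.

Lemma lead_uniq v d d' : lead v d -> lead v d' -> d = d'.
Proof.
move=> [[j jd vj] z] [[j' jd' vj'] z'].
case: (ltngtP d d') => // [dd'|d'd].
  by rewrite -jd in dd'; rewrite z' ?eqxx in vj.
by rewrite -jd' in d'd; rewrite z ?eqxx in vj'.
Qed.

Lemma leadZ v d a : a != 0 -> lead v d -> lead (a *: v) d.
Proof.
move=> a0 [[j jd vj] z]; split; first by exists j; rewrite // mxE mulf_neq0.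
by move=> k /z vk; rewrite mxE vk mulr0.
Qed.

Lemma upO_diag_neq0 u i : upO u -> u i i != 0.
Proof.
move=> Uu; have [_ uu] := Uu; have [_ uau] := upO_adj Uu.
have /matrixP/(_ i i) := proj1 Uu; rewrite mxE (bigD1 i) //= big1 => [|k ki].
  rewrite !mxE eqxx addr0 => E; apply: contra_eq_neq E => ->.
  by rewrite mulr0 eq_sym oner_eq0.
have [lt|] := ltnP k i; first by rewrite uau ?mul0r.
rewrite leq_eqVlt eq_sym val_eqE (negPf ki) => /uu ->; exact: mulr0.
Qed.

(** The columns up to [d] of an upper triangular [u] only involve the entries of [v]
up to [d], and the diagonal of [u] has no zero. *)
Lemma lead_mulmx v d u : upO u -> lead v d -> lead (v *m u) d.
Proof.
move=> Uu [[j jd vj] z]; have [_ uu] := Uu.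
have E (m : 'I_n) (k : 'I_n) : (m <= d)%N -> k != m -> v 0 k * u k m = 0.
  move=> md km; have [/z->|dk] := ltnP k d; first by rewrite mul0r.
  rewrite uu ?mulr0 // ltn_neqAle eq_sym val_eqE km /=.
  exact: leq_trans dk.
split=> [|m md].
  exists j => //; rewrite mxE (bigD1 j) //= big1 ?addr0 => [|k kj].
    by rewrite mulf_neq0 // upO_diag_neq0.
  by rewrite E ?jd.
rewrite mxE (bigD1 m) //= big1 ?addr0 => [|k km]; first by rewrite z ?mul0r.
by rewrite E // ltnW.
Qed.

(** The left factor fixes e_0, hence also its dual, and does not change this row. *)
Lemma lead_fixed_row g h d : equivB g h -> lead (row o g) d -> lead (row o h) d.
Proof.
move=> [b [u [Bb Uu ->]]] gd; rewrite !row_mul.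
have -> : row o b = delta_mx 0 o.
  by apply/rowP => j; rewrite mxE upO_fix_row // mxE eqxx.
by rewrite -rowE; apply: lead_mulmx.
Qed.

End Equivalence.

(** * From rank l to rank l+1 *)

Section Step.
Variables (F : numFieldType) (n : nat) (o : 'I_n).
Hypothesis rev_o : rev_ord o = o.
Implicit Types (q : 'I_n.+2) (g b u : 'M[F]_n.+2) (h : 'M[F]_n).
Let last : 'I_n.+2 := ord_max.
Let o' : 'I_n.+2 := skip last o.
Let hm : nmid last := nmid_max n.

Definition last_row_at g q := forall j, g last j = (j == q)%:R.

Lemma upper_last b : upper b -> forall j, j != last -> b last j = 0.
Proof.
move=> ub j jl; apply: ub; rewrite ltn_neqAle val_eqE jl /= -ltnS; exact: ltn_ord.
Qed.

Lemma upper_first b : upper b -> forall i, b (skip last i) (rev_ord last) = 0.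
Proof. by move=> ub i; apply: ub; rewrite /= subnn minn0 addnS. Qed.

Lemma last_row_col g q i : isO g -> last_row_at g q ->
  g i (rev_ord q) = (i == rev_ord last)%:R.
Proof.
move=> Og gq; rewrite -(isO_row i last Og) (bigD1 (rev_ord q)) //= rev_ordK.
rewrite gq eqxx mulr1 big1 ?addr0 // => k kq.
by rewrite gq -(inj_eq rev_ord_inj) rev_ordK (negPf kq) mulr0.
Qed.

Lemma last_row_nmid g q : isO g -> last_row_at g q -> nmid q.
Proof.
move=> Og gq; apply/eqP => qq; have := last_row_col last Og gq.
rewrite -qq gq eqxx; move: hm; rewrite /nmid => /negPf->.
by move/eqP; rewrite oner_eq0.
Qed.

(** The first row of an orthogonal matrix is determined by the other data, as it
pairs with the last one: orthogonality of the columns [j] and [q] gives the entry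
[j], and isotropy of the column [q] gives twice the entry [q]. *)
Lemma last_row_ext g g' q : isO g -> isO g' ->
  last_row_at g q -> last_row_at g' q -> del last q g = del last q g' ->
  (forall i, g (skip last i) q = g' (skip last i) q) -> g = g'.
Proof.
move=> Og Og' gq gq' dg cg; have hq := last_row_nmid Og gq.
have mid_eq i j : g (skip last i) j = g' (skip last i) j.
  case: (skipP j hq) => [||k]; rewrite ?cg ?last_row_col //.
  by have /matrixP/(_ i k) := dg; rewrite !mxE.
have first_eq j : g (rev_ord last) j = g' (rev_ord last) j.
  have key k (Ok : isO k) : last_row_at k q ->
      k (rev_ord last) j + k (rev_ord last) q * (j == q)%:R =
      (q == rev_ord j)%:R -
      \sum_i k (rev_ord (skip last i)) q * k (skip last i) j.
    move=> kq; rewrite -(isO_col q j Ok) (sum_skip _ hm) rev_ordK !kq eqxx.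
    by rewrite mul1r addrK addrC.
  have [jq|jq] := eqVneq j q.
    subst j; have := key g Og gq; have := key g' Og' gq'; rewrite eqxx !mulr1.
    under eq_bigr => i _ do rewrite rev_skip -!mid_eq -rev_skip.
    move=> <- /eqP; rewrite -!mulr2n -subr_eq0 -mulrnBl mulrn_eq0 /= subr_eq0.
    by move/eqP.
  have := key g Og gq; have := key g' Og' gq'; rewrite (negPf jq) !mulr0 !addr0.
  by move=> -> ->; congr (_ - _); apply: eq_bigr => i _; rewrite rev_skip !mid_eq.
apply/matrixP => i j; case: (skipP i hm) => [||k] //.
by rewrite gq gq'.
Qed.

(** The vector for which [col_shift v] adds to each middle row [i] the last row
multiplied by [v i]. *)
Definition col_shift_vec (v : 'I_n -> F) : 'rV[F]_n.+2 :=
  \row_j (if unskip last j is Some i then - v (rev_ord i) else 0).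

Definition col_shift v := eichler (rev_ord last) (col_shift_vec v).

Lemma col_shift_vec_skip v i : col_shift_vec v 0 (skip last i) = - v (rev_ord i).
Proof. by rewrite mxE unskip_skip. Qed.

Lemma col_shift_vec_last v : col_shift_vec v 0 last = 0.
Proof. by rewrite mxE unskip_self. Qed.

Lemma col_shift_vec_first v : col_shift_vec v 0 (rev_ord last) = 0.
Proof. by rewrite mxE unskip_rev. Qed.

Lemma first_nmid : rev_ord last != rev_ord (rev_ord last).
Proof. by rewrite rev_ordK eq_sym. Qed.

Lemma upO_col_shift v : upO (col_shift v).
Proof.
apply: eichler_upper => [|j]; first exact: first_nmid.
case: (skipP j hm) => [||i]; rewrite ?col_shift_vec_last ?col_shift_vec_first ?eqxx //.
by move=> _; rewrite /= subnn minn0 addnS.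
Qed.

Lemma col_shift_last v j : col_shift v last j = (j == last)%:R.
Proof.
rewrite eichlerE ?first_nmid ?col_shift_vec_first // rev_ordK.
move: hm; rewrite /nmid => /negPf->.
by rewrite !mul0r mulr0 mul0r !subr0 addr0 eq_sym.
Qed.

Lemma col_shift_skip v i j :
  col_shift v (skip last i) j = (j == skip last i)%:R + v i * (j == last)%:R.
Proof.
rewrite eichlerE ?first_nmid ?col_shift_vec_first // rev_ordK rev_skip.
rewrite col_shift_vec_skip rev_ordK skip_neq_rev // !mul0r mulr0 mul0r.
by rewrite addr0 subr0 mulNr opprK eq_sym.
Qed.

Lemma col_shift_fix v : v o = 0 -> upO_fix o' (col_shift v).
Proof.
move=> vo; split=> [|i]; first exact: upO_col_shift.
rewrite eichlerE ?first_nmid ?col_shift_vec_first // rev_ordK skip_neq //.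
by rewrite col_shift_vec_skip rev_o vo oppr0 !mulr0 subr0 addr0 subr0.
Qed.

Lemma col_shift_mul_last v g j : (col_shift v *m g) last j = g last j.
Proof.
rewrite mxE (bigD1 last) //= big1 ?addr0 => [|k kl]; rewrite col_shift_last.
  by rewrite eqxx mul1r.
by rewrite (negPf kl) mul0r.
Qed.

Lemma col_shift_mul_skip v g i j :
  (col_shift v *m g) (skip last i) j = g (skip last i) j + v i * g last j.
Proof.
rewrite mxE; under eq_bigr => k _ do rewrite col_shift_skip mulrDl -mulrA.
rewrite big_split /= -mulr_sumr (bigD1 (skip last i)) //= eqxx mul1r.
rewrite [X in _ + X + _]big1 => [|k ki]; last by rewrite (negPf ki) mul0r.
rewrite addr0 (bigD1 last) //= eqxx mul1r big1 ?addr0 // => k kl.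
by rewrite (negPf kl) mul0r.
Qed.

(** The normal form with last row at [q], induced matrix [h] and entry [t] of the
column [q] in the row of e_0. *)
Definition extend q t h : 'M[F]_n.+2 :=
  col_shift (fun i => t * (i == o)%:R) *m ins 1 last q h.

Lemma isO_extend q t h : nmid q -> isO h -> isO (extend q t h).
Proof.
move=> hq Oh; apply: isOM; first by case: (upO_col_shift (fun i => t * (i == o)%:R)).
by apply: isO_ins => //; rewrite oner_eq0.
Qed.

Lemma extend_last q t h : last_row_at (extend q t h) q.
Proof. by move=> j; rewrite col_shift_mul_last ins_self // mul1r. Qed.

Lemma del_extend q t h : nmid q -> del last q (extend q t h) = h.
Proof.
move=> hq; apply/matrixP => i j.
by rewrite mxE col_shift_mul_skip ins_skip ins_self // skip_neq // mulr0 mulr0 addr0.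
Qed.

Lemma extend_col q t h i : nmid q ->
  extend q t h (skip last i) q = t * (i == o)%:R.
Proof.
move=> hq; rewrite col_shift_mul_skip ins_skip_self // ins_self // eqxx.
by rewrite add0r !mulr1.
Qed.

(** A column shift that fixes e_0 clears the entries of the column [q] in all the
middle rows but that of e_0. *)
Lemma equivB_extend g q : isO g -> last_row_at g q ->
  equivB o' g (extend q (g o' q) (del last q g)).
Proof.
move=> Og gq; have hq := last_row_nmid Og gq.
pose v i := if i == o then 0 else - g (skip last i) q.
have vo : v o = 0 by rewrite /v eqxx.
suff <- : col_shift v *m g = extend q (g o' q) (del last q g).
  exact/equivB_left/col_shift_fix.
have Ov : isO (col_shift v *m g).
  by apply: isOM => //; case: (upO_col_shift v).
have Oh : isO (del last q g).
  by apply: isO_del => // j; rewrite gq skip_neq.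
apply: (@last_row_ext _ _ q) => //.
- exact: isO_extend.
- by move=> j; rewrite col_shift_mul_last gq.
- exact: extend_last.
- rewrite del_extend //; apply/matrixP => i j.
  by rewrite mxE col_shift_mul_skip gq skip_neq // mulr0 addr0 mxE.
move=> i; rewrite col_shift_mul_skip gq eqxx mulr1 extend_col // /v.
by case: eqP => [->|_]; rewrite ?addr0 ?mulr1 // subrr mulr0.
Qed.

Lemma upO_fix_ins (t : F) (b : 'M[F]_n) : t != 0 -> upO_fix o b -> upO_fix o' (ins t last last b).
Proof.
move=> t0 [Ub bo]; split=> [|i]; first exact: upO_ins.
case: (skipP i hm) => [||k].
- by rewrite ins_self // skip_neq // mulr0 eq_sym skip_neq.
- by rewrite ins_rev // skip_neq_rev // mulr0 eq_sym skip_neq_rev.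
by rewrite ins_skip bo (inj_eq (@skip_inj _ last)).
Qed.

(** Multiply the last row by [t] and the column [q] by its inverse. *)
Lemma equivB_extend_scale q t h : nmid q -> isO h -> t != 0 ->
  equivB o' (extend q t h) (extend q 1 h).
Proof.
move=> hq Oh t0; set g := extend q t h.
have Og : isO g by exact: isO_extend.
pose L := ins t last last (1%:M : 'M[F]_n); pose R := ins t^-1 q q (1%:M : 'M[F]_n).
have gLR : equivB o' g (L *m g *m R).
  exists L, R; split=> //; first by apply: upO_fix_ins => //; apply: upO_fix1.
  by apply: upO_ins; rewrite ?invr_eq0 //; apply: upO1.
have OLR := equivB_isO gLR Og.
have RE i (k : 'M[F]_n.+2) : (k *m R) i q = k i q * t^-1.
  rewrite mxE (sum_skip _ hq) ins_self // eqxx mulr1 ins_rev //.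
  move: hq; rewrite /nmid => /negPf nq; rewrite nq !mulr0 addr0 big1 ?addr0 //.
  by move=> m _; rewrite ins_skip_self ?mulr0 // /nmid nq.
have L1 j : (L *m g) last j = t * (j == q)%:R.
  rewrite mxE (bigD1 last) //= ins_self // eqxx mulr1 extend_last.
  by rewrite big1 ?addr0 // => k kl; rewrite ins_self // (negPf kl) mulr0 mul0r.
have L2 i j : (L *m g) (skip last i) j = g (skip last i) j.
  rewrite mxE (sum_skip _ hm) ins_skip_self // ins_skip_rev // !mul0r !add0r.
  rewrite (bigD1 i) //= ins_skip mxE eqxx mul1r big1 ?addr0 // => k ki.
  by rewrite ins_skip mxE eq_sym (negPf ki) mul0r.
have LRq : last_row_at (L *m g *m R) q.
  move=> j; rewrite mxE (bigD1 q) //= L1 eqxx mulr1 ins_self // mulrA divff // mul1r.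
  by rewrite big1 ?addr0 // => k kq; rewrite L1 (negPf kq) mulr0 mul0r.
have dLR : del last q (L *m g *m R) = h.
  rewrite (delM hq); first last.
  - by move=> i; rewrite L2 last_row_col ?skip_neq_rev //; apply: extend_last.
  - by move=> j; rewrite ins_self // skip_neq // mulr0.
  rewrite del_ins mulmx1; apply/matrixP => i j; rewrite mxE L2.
  by have /matrixP/(_ i j) := del_extend t h hq; rewrite mxE.
apply: equivB_trans gLR _; have := equivB_extend OLR LRq.
rewrite dLR RE // L2 extend_col // eqxx mulr1 divff //.
Qed.

(** An Eichler transformation on the right subtracts a multiple of the column
[skip q j] from the column [q].  It is upper triangular because the former comes
first, and otherwise it only changes the first row. *)
Lemma equivB_extend_clear q t h j : nmid q -> isO h ->
  h o j != 0 -> (skip q j < q)%N -> equivB o' (extend q t h) (extend q 0 h).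
Proof.
move=> hq Oh hj jq; set g := extend q t h; set p := rev_ord q.
have Og : isO g by exact: isO_extend.
(* [s] is chosen so that [t - s * h o j = 0] *)
pose s := t / h o j; pose y : 'rV[F]_n.+2 := \row_k (s * (k == skip q (rev_ord j))%:R).
have hp : p != rev_ord p by rewrite rev_ordK eq_sym.
have yE k : y 0 k = s * (k == skip q (rev_ord j))%:R by rewrite mxE.
have yp : y 0 p = 0 by rewrite yE eq_sym skip_neq_rev // mulr0.
have yq : y 0 q = 0 by rewrite yE eq_sym skip_neq // mulr0.
have UE : upO (eichler p y).
  apply: eichler_upper => // k; rewrite yE; case: (k =P _) => [-> _|]; last first.
    by rewrite mulr0 eqxx.
  by rewrite -rev_skip /=; have := ltn_ord q; move: jq; rewrite /=; lia.
have gE := equivB_right o' g UE; have OE := equivB_isO gE Og.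
have gpE i : g (skip last i) p = 0.
  by rewrite last_row_col ?skip_neq_rev //; apply: extend_last.
have Eq k : eichler p y q k = (k == q)%:R.
  rewrite eichlerE // rev_ordK -/p yp (negPf hq) !mul0r mulr0 mul0r.
  by rewrite !subr0 addr0 eq_sym.
have LE : last_row_at (g *m eichler p y) q.
  move=> k; rewrite mxE (bigD1 q) //= extend_last eqxx mul1r Eq big1 ?addr0 //.
  by move=> m mq; rewrite extend_last (negPf mq) mul0r.
have dE : del last q (g *m eichler p y) = h.
  rewrite (delM hq) //; last by move=> k; rewrite Eq skip_neq.
  rewrite del_extend // (_ : del q q _ = 1%:M) ?mulmx1 //.
  apply/matrixP => i k; rewrite mxE [RHS]mxE eichlerE // rev_ordK skip_neq_rev // skip_neq //.
  by rewrite !mul0r !mulr0 addr0 !subr0 (inj_eq (@skip_inj _ q)).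
apply: equivB_trans gE _; have := equivB_extend OE LE; rewrite dE.
suff -> : (g *m eichler p y) o' q = 0 by [].
rewrite mxE (sum_skip _ hq) -/p gpE mul0r addr0 Eq eqxx mulr1.
rewrite extend_col // eqxx mulr1 (bigD1 j) //= big1 => [|k kj].
  rewrite eichlerE // rev_ordK skip_neq // skip_neq_rev // yq eqxx rev_skip yE eqxx.
  have -> : g o' (skip q j) = h o j.
    by have /matrixP/(_ o j) := del_extend t h hq; rewrite mxE.
  rewrite /= !(mulr0, mul0r, mulr1, subr0, addr0, add0r) /s.
  by field.
rewrite eichlerE // rev_ordK skip_neq // skip_neq_rev // yq eqxx rev_skip yE.
rewrite (inj_eq (@skip_inj _ q)) (inj_eq rev_ord_inj) (negPf kj).
by rewrite !mul0r !mulr0 !mul0r !subr0 addr0 mulr0.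
Qed.

Lemma equivB_last_row g : isO g ->
  exists q g', equivB o' g g' /\ last_row_at g' q.
Proof.
move=> Og; have qg : qform (row last g) = 0.
  rewrite /qform; under eq_bigr => k _ do rewrite !mxE.
  by rewrite isO_row //; move: hm; rewrite /nmid => /negPf->.
have [q0 vq0] : exists q, row last g 0 q != 0.
  apply/existsP; apply: contraT; rewrite negb_exists => /forallP v0.
  have := isO_row last (rev_ord last) Og; rewrite rev_ordK eqxx big1 => [/eqP|k _].
    by rewrite eq_sym oner_eq0.
  by move: (v0 k); rewrite negbK mxE => /eqP ->; rewrite mul0r.
case: (@arg_minnP _ q0 (fun q => row last g 0 q != 0) val vq0) => q vq qmin.
have [|hq [u Uu vu]] := row_normal_form qg vq.
  by move=> j jq; apply: contraTeq jq => /qmin; rewrite -leqNgt.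
exists q, (g *m u); split; first exact: equivB_right.
move=> j; have /rowP/(_ j) := vu; rewrite -row_mul mxE => ->.
by rewrite mxE eqxx.
Qed.

(** An equivalence of induced matrices lifts by letting both factors act trivially
on the hyperbolic planes involved. *)
Lemma equivB_lift g q h : isO g -> last_row_at g q -> equivB o (del last q g) h ->
  exists g', [/\ equivB o' g g', last_row_at g' q & del last q g' = h].
Proof.
move=> Og gq [b [u [Bb Uu ->]]]; have hq := last_row_nmid Og gq.
have n1 : 1 != 0 :> F by rewrite oner_eq0.
pose b' := ins 1 last last b; pose u' := ins 1 q q u.
have L1 j : (b' *m g) last j = (j == q)%:R.
  rewrite mxE (bigD1 last) //= ins_self // eqxx mulr1 gq mul1r.
  by rewrite big1 ?addr0 // => k kl; rewrite ins_self // (negPf kl) mulr0 mul0r.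
exists (b' *m g *m u'); split.
- by exists b', u'; split=> //; [apply: upO_fix_ins | apply: upO_ins].
- move=> j; rewrite mxE (bigD1 q) //= L1 eqxx mul1r ins_self // mul1r.
  by rewrite big1 ?addr0 // => k kq; rewrite L1 (negPf kq) mul0r.
rewrite (delM hq); first last.
- move=> i; rewrite mxE (sum_skip _ hm) ins_skip_self // ins_skip_rev // !mul0r.
  rewrite !add0r big1 // => k _.
  by rewrite last_row_col // skip_neq_rev // mulr0.
- by move=> j; rewrite ins_self // skip_neq // mulr0.
rewrite (delM hm); first last.
- by move=> i; rewrite ins_skip_rev.
- by move=> j; rewrite gq skip_neq.
by rewrite !del_ins.
Qed.

(** As both last rows are at [q], the row [q] of the right factor is a multiple of the
coordinate vector; so the factors induce factors of the same kind between the
induced matrices. *)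
Lemma equivB_del g g' q : isO g -> last_row_at g q -> last_row_at g' q ->
  equivB o' g g' -> equivB o (del last q g) (del last q g').
Proof.
move=> Og gq gq' [b [u [Bb Uu gE]]]; have hq := last_row_nmid Og gq.
have [[Ob ub] bo] := Bb; have [Ou uu] := Uu.
have bl := upO_diag_neq0 last (proj1 Bb).
have bgl j : (b *m g) last j = b last last * (j == q)%:R.
  rewrite mxE (bigD1 last) //= gq big1 ?addr0 // => k kl.
  by rewrite upper_last ?mul0r.
have uq j : u q (skip q j) = 0.
  have := gq' (skip q j); rewrite gE mxE (bigD1 q) //= bgl eqxx mulr1 skip_neq //.
  rewrite big1 ?addr0 => [|k kq]; last by rewrite bgl (negPf kq) mulr0 mul0r.
  by move/eqP; rewrite mulf_eq0 (negPf bl) => /eqP.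
exists (del last last b), (del q q u); split.
- split; first split.
  + by apply: isO_del => // j; rewrite upper_last ?skip_neq.
  + by move=> i j ji; rewrite mxE ub // ltn_skip.
  by move=> i; rewrite mxE bo (inj_eq (@skip_inj _ last)).
- split; first by apply: isO_del.
  by move=> i j ji; rewrite mxE uu // ltn_skip.
rewrite gE (delM hq) //; last first.
  move=> i; rewrite mxE (bigD1 (rev_ord last)) //= upper_first // mul0r add0r.
  by rewrite big1 // => k kl; rewrite last_row_col // (negPf kl) mulr0.
rewrite (delM hm) //; last by move=> i; rewrite upper_first.
by move=> j; rewrite gq skip_neq.
Qed.

Lemma equivB_last_row_eq g g' q q' : last_row_at g q -> last_row_at g' q' ->
  equivB o' g g' -> q = q'.
Proof.
move=> gq gq' [b [u [[Ub _] Uu gE]]]; apply: val_inj.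
have L k p : last_row_at k p -> lead (row last k) p.
  move=> kp; split; first by exists p; rewrite // mxE kp eqxx oner_eq0.
  by move=> j jp; rewrite mxE kp; case: eqP jp => // ->; rewrite ltnn.
apply: lead_uniq (L _ _ gq').
have -> : row last g' = b last last *: (row last g *m u).
  have rb : row last b = b last last *: delta_mx 0 last.
    apply/rowP => j; rewrite !mxE eqxx; case: eqP => [->|/eqP jl].
      by rewrite mulr1.
    by rewrite mulr0 upper_last //; case: Ub.
  by rewrite gE !row_mul rb -!scalemxAl -rowE.
by apply: leadZ; [exact: upO_diag_neq0 | apply: lead_mulmx => //; apply: L].
Qed.

Lemma lead_extend0 q h (d : 'I_n) : nmid q -> isO h ->
  lead (row o h) d -> lead (row o' (extend q 0 h)) (skip q d).
Proof.
move=> hq Oh [[j jd hj] z]; have {j jd hj} hd : h o d != 0.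
  by move: hj; rewrite mxE (_ : j = d) //; apply: val_inj.
have E k : extend q 0 h o' (skip q k) = h o k.
  by have /matrixP/(_ o k) := del_extend 0 h hq; rewrite mxE.
split; first by exists (skip q d); rewrite // mxE E.
move=> k; rewrite mxE; case: (skipP k hq) => [||k'].
- by rewrite extend_col // mul0r.
- by rewrite last_row_col ?skip_neq_rev //; [apply: isO_extend | apply: extend_last].
by rewrite ltn_skip E => /z; rewrite mxE.
Qed.

(** Here [q <= d] ensures that the new entry 1 comes before all the nonzero entries
inherited from [h]. *)
Lemma lead_extend1 q h d : nmid q -> isO h ->
  lead (row o h) d -> (q <= d)%N -> lead (row o' (extend q 1 h)) q.
Proof.
move=> hq Oh [_ z] qd.
split; first by exists q; rewrite // mxE extend_col // eqxx mulr1 oner_eq0.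
move=> k; rewrite mxE; case: (skipP k hq) => [||k']; first by rewrite ltnn.
- by rewrite last_row_col ?skip_neq_rev //; [apply: isO_extend | apply: extend_last].
have /matrixP/(_ o k') := del_extend 1 h hq; rewrite mxE => -> kq.
have := z k'; rewrite mxE; apply; apply: leq_trans qd; move: kq; rewrite /=; lia.
Qed.

End Step.

(** * Codes of double cosets *)

(** A letter is the choice of one more row of a signed partial permutation matrix:
[(a, Some s)] puts an entry of sign [s] in a new column at place [a], and
[(a, None)] leaves the row empty and adds an empty column at place [a]. *)
Definition letter : eqType := (nat * option bool)%type.

(** The number of columns before the first empty one.  A new column moves it when it
is inserted at or before this place. *)
Fixpoint level (w : seq letter) : nat :=
  if w is x :: w' then
    if x.2 is None then x.1 else level w' + (x.1 <= level w')
  else 0.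

Definition letters l d : seq letter :=
  [seq (a, Some s) | s <- [:: true; false], a <- iota 0 l.+1] ++
  [seq (a, None) | a <- iota 0 d.+1].

Fixpoint codes l : seq (seq letter) :=
  if l is l'.+1 then [seq x :: w | w <- codes l', x <- letters l' (level w)]
  else [:: [::]].

Lemma mem_letters l d (x : letter) :
  (x \in letters l d) = (if x.2 is None then x.1 <= d else x.1 <= l)%N.
Proof.
case: x => a k; rewrite mem_cat; apply/orP/idP.
  case=> [/allpairsPdep[s [b [_ + [-> ->]]]]|/mapP[b + [-> ->]]];
  by rewrite mem_iota add0n ltnS.
case: k => [s|] ad; [left|right].
  apply/allpairsPdep; exists s, a; split=> //; first by case: (s).
  by rewrite mem_iota add0n ltnS.
by apply/mapP; exists a; rewrite // mem_iota add0n ltnS.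
Qed.

Lemma codes_consP l w : reflect
  (exists x w', [/\ w = x :: w', w' \in codes l & x \in letters l (level w')])
  (w \in codes l.+1).
Proof.
apply: (iffP allpairsPdep) => [[w' [x [? ? ->]]]|[x [w' [-> ? ?]]]];
by [exists x, w' | exists w', x].
Qed.

Lemma level_le l w : w \in codes l -> (level w <= l)%N.
Proof.
elim: l w => [|l IH] w; first by rewrite inE => /eqP ->.
move=> /codes_consP[[a k] [w' [-> /IH lw]]]; rewrite mem_letters /=.
by case: k => [s|] al; lia.
Qed.

Lemma uniq_letters l d : uniq (letters l d).
Proof.
rewrite cat_uniq; apply/and3P; split.
- by apply: allpairs_uniq; rewrite ?iota_uniq // => -[s a] [s' a'] _ _ [-> ->].
- apply/hasPn => _ /mapP[a _ ->]; apply/allpairsPdep => -[s [b [_ _]]].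
  by [].
- by rewrite map_inj_uniq ?iota_uniq // => a b [->].
Qed.

Lemma uniq_codes l : uniq (codes l).
Proof.
elim: l => [|l IH] //.
apply: (@allpairs_uniq_dep _ (fun=> letter) _ (fun w x => x :: w)) => //.
  by move=> w _; apply: uniq_letters.
by move=> [w x] [w' x'] _ _ /= [-> ->].
Qed.

(** * The representative attached to a code *)

Section Representatives.
Variable F : numFieldType.

Definition mid l : 'I_(l.*2.+1) := inord l.

Lemma val_mid l : mid l = l :> nat.
Proof. by rewrite inordK // -addnn; lia. Qed.

Lemma rev_mid l : rev_ord (mid l) = mid l.
Proof. by apply: val_inj; rewrite /= val_mid; lia. Qed.

Lemma skip_mid l : skip ord_max (mid l) = mid l.+1.
Proof.
by apply: val_inj; rewrite [RHS](val_mid l.+1) /= val_mid subnn minn0 leq0n; lia.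
Qed.

(** The sign [false] stands for the mirror image of the place. *)
Definition letter_pos l (x : letter) : 'I_(l.*2.+1.+2) :=
  inord (if x.2 == Some false then l.*2.+2 - x.1 else x.1)%N.

Fixpoint rep l (w : seq letter) : 'M[F]_(l.*2.+1) :=
  if l is l'.+1 then
    if w is x :: w' then extend (mid l') (letter_pos l' x) (x.2 == None)%:R (rep l' w')
    else 1%:M
  else 1%:M.

Lemma val_letter_pos l d x : x \in letters l d -> (d <= l)%N ->
  letter_pos l x = (if x.2 == Some false then l.*2.+2 - x.1 else x.1)%N :> nat.
Proof.
by case: x => a [[]|]; rewrite mem_letters /= => al dl; rewrite inordK //=; lia.
Qed.

Lemma nmid_letter_pos l d x : x \in letters l d -> (d <= l)%N -> nmid (letter_pos l x).
Proof.
move=> xl dl; rewrite nmidE /= (val_letter_pos xl dl).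
by case: x xl => a [[]|]; rewrite mem_letters /=; lia.
Qed.

Lemma isO_rep l w : w \in codes l -> isO (rep l w).
Proof.
elim: l w => [|l IH] w; first by move=> _; apply: isO1.
move=> /codes_consP[x [w' [-> wl xl]]]; apply: isO_extend; last exact: IH.
by apply: nmid_letter_pos xl _; apply: level_le.
Qed.

(** The level is read off the row of e_0, so it is an invariant of the double coset. *)
Lemma lead_rep l w : w \in codes l -> lead (row (mid l) (rep l w)) (level w).
Proof.
elim: l w => [|l IH] w.
  rewrite inE => /eqP -> /=; split=> //; exists (mid 0); first by rewrite val_mid.
  by rewrite !mxE eqxx oner_eq0.
move=> /codes_consP[x [w' [-> wl xl]]]; have dl := level_le wl.
have hq := nmid_letter_pos xl dl; have vq := val_letter_pos xl dl.
have Oh := isO_rep wl; rewrite -skip_mid /=.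
case: x xl hq vq => a [s|]; rewrite mem_letters /= => al hq vq; last first.
  have := lead_extend1 hq Oh (IH _ wl).
  by rewrite vq; apply.
have d1 : (level w' < l.*2.+1)%N by lia.
have := lead_extend0 hq Oh (d := Ordinal d1) (IH _ wl).
suff -> : skip (letter_pos l (a, Some s)) (Ordinal d1) =
  (level w' + (a <= level w'))%N :> nat by [].
by rewrite /= vq; case: s {hq vq} => /=; lia.
Qed.

(** The position of the last row, the double coset of the induced matrix and the level
are invariants.  A letter [(a, Some true)] and a letter [(a, None)] with the same
position give different levels, since the second one requires [a] to be at most
the previous level. *)
Lemma equivB_rep_inj l w w' : w \in codes l -> w' \in codes l ->
  equivB (mid l) (rep l w) (rep l w') -> w = w'.
Proof.
elim: l w w' => [|l IH] w w'; first by rewrite !inE => /eqP-> /eqP->.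
move=> wl wl' E; have lw := lead_rep wl; have lw' := lead_rep wl'.
have {lw lw'} lE := lead_uniq (lead_fixed_row (rev_mid _) E lw) lw'.
case/codes_consP: wl lE E => x [v [-> vl xl]].
case/codes_consP: wl' => x' [v' [-> vl' xl']] lE.
rewrite -skip_mid /= => E.
have dl := level_le vl; have dl' := level_le vl'.
have hq := nmid_letter_pos xl dl; have hq' := nmid_letter_pos xl' dl'.
have Oh := isO_rep vl; have Oh' := isO_rep vl'.
have L y k t : last_row_at (extend (mid l) y t (rep l k)) y by exact: extend_last.
have qE := equivB_last_row_eq (L _ _ _) (L _ _ _) E.
have Lx' : last_row_at (extend (mid l) (letter_pos l x') (x'.2 == None)%:R (rep l v'))
  (letter_pos l x) by rewrite qE; apply: L.
have := equivB_del (isO_extend _ _ hq Oh) (L _ _ _) Lx' E.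
rewrite del_extend // qE del_extend // => /(IH _ _ vl vl') vE.
move: lE; rewrite -{}vE in xl' qE *; have := congr1 (@nat_of_ord _) qE.
rewrite (val_letter_pos xl dl) (val_letter_pos xl' dl).
case: x x' xl xl' {hq hq' qE L E Lx'} => a [[]|] [a' [[]|]];
  rewrite !mem_letters /= => al al' aE lE; congr ((_, _) :: _); lia.
Qed.

(** With [q] the position of the last row, [t] can be cleared when [q] exceeds the level of
the induced matrix.  Otherwise it is 0 or can be scaled to 1. *)
Lemma equivB_rep l (g : 'M[F]_(l.*2.+1)) : isO g ->
  exists2 w, w \in codes l & equivB (mid l) g (rep l w).
Proof.
elim: l g => [|l IH] g Og.
  exists [::]; rewrite ?inE // /rep -(isO_mulV Og); apply: equivB_right.
  by split; [exact: isO_adj | move=> i j; rewrite (ord1 i) (ord1 j)].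
have [q [g1 [E1 L1]]] := equivB_last_row (mid l) Og.
have O1 := equivB_isO E1 Og; have hq := last_row_nmid O1 L1.
have [|w wl Ew] := IH (del ord_max q g1).
  by apply: isO_del => // [|j]; rewrite ?nmid_max // L1 skip_neq.
have [g2 [E2 L2 d2]] := equivB_lift O1 L1 Ew.
have E3 := equivB_extend (rev_mid l) (equivB_isO E2 O1) L2.
have {E1 E2 E3} := equivB_trans (equivB_trans E1 E2) E3; rewrite d2.
set t := g2 _ _ => E; have Oh := isO_rep wl; have dl := level_le wl.
pose x s : letter := ((if q <= l then q : nat else l.*2.+2 - q)%N, s).
have ql : q != l.+1 :> nat.
  by move: hq; rewrite nmidE /=; have := ltn_ord q; lia.
have pos s : (if s is None then q <= l else s == Some (q <= l))%N ->
    letter_pos l (x s) = q.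
  move=> sq; suff val_q : (if s == Some false then l.*2.+2 - (x s).1 else (x s).1)%N = q.
    by apply: ord_inj; rewrite inordK /= val_q.
  rewrite /x /=; have lq := ltn_ord q.
  by case: s sq => [b /eqP[->]|]; case: leqP => //=; lia.
suff [s [sx Es]] : exists s, x s \in letters l (level w) /\
    equivB (skip ord_max (mid l)) (extend (mid l) q t (rep l w))
      (extend (mid l) (letter_pos l (x s)) (s == None)%:R (rep l w)).
  exists (x s :: w); first by apply/codes_consP; exists (x s), w.
  by rewrite -skip_mid; apply: equivB_trans E Es.
have [qd|dq] := leqP q (level w).
  have ql' : (q <= l)%N by exact: leq_trans qd dl.
  have [t0|t0] := eqVneq t 0.
    exists (Some true); rewrite mem_letters pos ?ql' //= ql' t0.
    by split=> //; apply: equivB_refl.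
  exists None; rewrite mem_letters pos //= ql'; split=> //.
  by apply: equivB_extend_scale; rewrite ?rev_mid.
exists (Some (q <= l)%N); rewrite mem_letters pos //=; split.
  by have := ltn_ord q; case: (leqP q l) ql; lia.
have [[j jd hj] _] := lead_rep wl; rewrite mxE in hj.
apply: (@equivB_extend_clear _ _ _ (rev_mid l) _ t _ _ hq Oh hj).
by rewrite /= jd; have := ltn_ord q; move: ql dq dl; lia.
Qed.

End Representatives.

(** * Counting the codes *)

Section Count.
Local Open Scope nat_scope.

Lemma sum_bin n j : \sum_(a < n) 'C(a, j) = 'C(n, j.+1).
Proof.
elim: n => [|n IH]; first by rewrite big_ord0 bin0n.
by rewrite big_ord_recr /= IH binS.
Qed.

Lemma sum_iota n (f : nat -> nat) : \sum_(a <- iota 0 n) f a = \sum_(a < n) f a.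
Proof. by rewrite -(big_mkord xpredT) /index_iota subn0. Qed.

Lemma sum_level_signed l d j : d <= l ->
  \sum_(a < l.+1) 'C(d + (a <= d), j) = (l.+1 + j) * 'C(d, j) + j * 'C(d, j.-1).
Proof.
move=> dl; rewrite -(subnKC (_ : d.+1 <= l.+1)) // big_split_ord /= subSS.
under eq_bigr => a _ do rewrite -ltnS ltn_ord addn1.
under [X in _ + X]eq_bigr => a _ do rewrite leqNgt ltnS leq_addr addn0.
rewrite !sum_nat_const !card_ord.
case: j => [|j] /=; first by rewrite !bin0; lia.
have := mul_bin_diag d.+1 j; rewrite /= !binS; nia.
Qed.

Lemma sum_letters l d j : d <= l ->
  \sum_(x <- letters l d) 'C(if x.2 is None then x.1 else d + (x.1 <= d), j) =
  2 * ((l.+1 + j) * 'C(d, j) + j * 'C(d, j.-1)) + ('C(d, j) + 'C(d, j.+1)).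
Proof.
move=> dl; move: (sum_iota l.+1) (sum_iota d.+1); rewrite /letters.
move: (iota 0 l.+1) (iota 0 d.+1) => r r' sum_r sum_r'.
rewrite big_cat big_map big_allpairs_dep !big_cons big_nil /= addn0 addnn -mul2n.
by rewrite sum_r sum_r' sum_level_signed // sum_bin binS [X in _ + X]addnC.
Qed.

(** The contribution of the placements with [k] empty rows to the sum of
'C(level w, j): the places of the [k] empty columns and of the [j] chosen columns
before the first of them form a subset of size [k + j]. *)
Definition count_sum l k j := 2 ^ (l - k) * (l - k)`! * 'C(l, k) * 'C(l, k + j).

(** Part of the recursion for [count_sum]: placements where the first row is not
empty. *)
Lemma count_sum_diag l k j : k <= l ->
  2 ^ (l.+1 - k) * (l.+1 - k)`! * 'C(l, k) * 'C(l.+1, k + j) =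
  2 * ((l.+1 + j) * count_sum l k j + j * count_sum l k j.-1).
Proof.
move=> kl; have key : (l.+1 - k) * 'C(l.+1, k + j) =
    (l.+1 + j) * 'C(l, k + j) + j * 'C(l, k + j.-1).
  case: j => [|j]; first by rewrite !addn0 -mul_bin_down.
  have := mul_bin_down l.+1 (k + j.+1); rewrite /= addnS.
  have [le|lt] := leqP (k + j).+1 l.+1; last by rewrite !bin_small //; lia.
  rewrite binS; nia.
rewrite /count_sum subSn // expnS factS -subSn //.
have -> : 2 * 2 ^ (l - k) * ((l.+1 - k) * (l - k)`!) * 'C(l, k) * 'C(l.+1, k + j)
  = 2 * (2 ^ (l - k) * (l - k)`! * 'C(l, k)) * ((l.+1 - k) * 'C(l.+1, k + j)) by ring.
by rewrite key; ring.
Qed.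

(** Both sides satisfy the recursion of [sum_letters]; the binomials of size [j] at the
level turn into binomials of sizes [j - 1], [j] and [j + 1], which is why the
statement is needed for all [j] at once. *)
Lemma sum_codes l j :
  \sum_(w <- codes l) 'C(level w, j) = \sum_(k < l.+1) count_sum l k j.
Proof.
elim: l j => [|l IH] j.
  by rewrite big_seq1 big_ord1 /count_sum /= !mul1n add0n.
rewrite big_allpairs_dep /= big_seq.
under eq_bigr => w wl do rewrite (sum_letters _ (level_le wl)).
rewrite -big_seq big_split -big_distrr /= big_split -!big_distrr /= big_split !IH /=.
have -> : \sum_(k < l.+2) count_sum l.+1 k j =
  \sum_(k < l.+1) 2 ^ (l.+1 - k) * (l.+1 - k)`! * 'C(l, k) * 'C(l.+1, k + j) +
  \sum_(k < l.+1) 2 ^ (l - k) * (l - k)`! * 'C(l, k) * 'C(l.+1, k.+1 + j).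
  rewrite [in RHS](_ : \sum_(k < l.+1) 2 ^ (l.+1 - k) * (l.+1 - k)`! * 'C(l, k) * 'C(l.+1, k + j)
    = \sum_(k < l.+2) 2 ^ (l.+1 - k) * (l.+1 - k)`! * 'C(l, k) * 'C(l.+1, k + j)).
    rewrite [in RHS]big_ord_recl [in LHS]big_ord_recl /= -addnA -big_split /=.
    congr (_ + _); first by rewrite /count_sum !bin0.
    by apply: eq_bigr => k _; rewrite /count_sum /bump /= add1n subSS binS; ring.
  by rewrite [in RHS]big_ord_recr /= bin_small // muln0 mul0n addn0.
congr (_ + _).
  rewrite !big_distrr -big_split big_distrr; apply: eq_bigr => k _ /=.
  by rewrite count_sum_diag // -ltnS.
rewrite -big_split; apply: eq_bigr => k _ /=.
by rewrite /count_sum addSn binS addnS; ring.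
Qed.

Theorem size_codes l :
  size (codes l) = \sum_(k < l.+1) 2 ^ (l - k) * (l - k)`! * 'C(l, k) ^ 2.
Proof.
rewrite -sum1_size; under eq_bigr => w _ do rewrite -(bin0 (level w)).
rewrite sum_codes; apply: eq_bigr => k _.
by rewrite /count_sum addn0 -mulnA mulnn.
Qed.

End Count.

(** * The generating function *)

Section GeneratingFunction.

Definition geom : fps := fps_inv (fps_poly (1 - 2 *: 'X)).

Lemma geomE n : geom n = 2 ^+ n.
Proof.
pose g := fps_poly (1 - 2 *: 'X).
have g0 : g 0%N = 1 by rewrite /g /fps_poly coefB coefZ coefX coef1 mulr0 subr0.
have g1 : g 1%N = - 2 by rewrite /g /fps_poly coefB coefZ coefX coef1 mulr1 sub0r.
have gS k : g k.+2 = 0 by rewrite /g /fps_poly coefB coefZ coefX coef1 mulr0 subr0.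
have inv : fps_mul geom g =1 fps_poly 1 by apply: fps_mul_inv; rewrite -/g g0 oner_eq0.
clearbody g; elim: n => [|n IH].
  by have := inv 0%N; rewrite /fps_mul big_ord1 subnn g0 mulr1 /fps_poly coef1.
have := inv n.+1; rewrite /fps_mul /fps_poly coef1 !big_ord_recr /=.
rewrite subnn subSnn g0 g1 big1 => [|i _]; last first.
  have -> : (n.+1 - i)%N = (n.-1 - i).+2 by have := ltn_ord i; lia.
  by rewrite gS mulr0.
by rewrite IH add0r mulr1 exprS mulrN addrC => /eqP; rewrite subr_eq0 mulrC => /eqP.
Qed.

Definition frac : fps := fps_div (fps_poly 'X) (fps_poly (1 - 2 *: 'X)).

Lemma fracE n : frac n = if n is m.+1 then 2 ^+ m else 0.
Proof.
rewrite /frac /fps_div -/geom /fps_mul; case: n => [|n].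
  by rewrite big_ord1 /fps_poly coefX mul0r.
rewrite big_ord_recl big_ord_recl /= /fps_poly !coefX /= mul0r mul1r add0r.
rewrite /bump /= subSS subn0 geomE big1 ?addr0 // => i _.
by rewrite coefX mul0r.
Qed.

(** Multiplication by x / (1 - 2x) is multiplication by 1 / (1 - 2x) and a shift. *)
Lemma frac_powS k n : fps_pow frac k.+1 n =
  if n is m.+1 then fps_mul (fps_pow frac k) geom m else 0.
Proof.
rewrite /fps_pow iterS -/(fps_pow frac k) /fps_mul; case: n => [|n].
  by rewrite big_ord1 fracE mul0r.
rewrite big_ord_recl fracE mul0r add0r (reindex_inj rev_ord_inj) /=.
apply: eq_bigr => i _; rewrite fracE /bump /= geomE mulrC.
by congr (fps_pow _ _ _ * _); have := ltn_ord i; lia.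
Qed.

(** The coefficients of x^k / (1 - 2x)^(k+1): the quotient by 1 - 2x turns the
previous lemma into Pascal's rule. *)
Lemma frac_pow_geom k n :
  fps_mul (fps_pow frac k) geom n = ('C(n, k) * 2 ^ (n - k))%:R.
Proof.
elim: k n => [|k IH] n.
  rewrite /fps_mul big_ord_recl big1 => [|i _]; rewrite /= /fps_poly coef1 ?mul0r //.
  by rewrite mul1r addr0 subn0 geomE bin0 mul1n natrX.
elim: n => [|n IHn].
  by rewrite /fps_mul big_ord1 frac_powS mul0r bin0n mul0n.
have -> : fps_mul (fps_pow frac k.+1) geom n.+1 =
    2 * fps_mul (fps_pow frac k.+1) geom n + fps_pow frac k.+1 n.+1.
  rewrite /fps_mul big_ord_recr /= subnn geomE mulr1 mulr_sumr; congr (_ + _).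
  apply: eq_bigr => i _; rewrite !geomE subSn; last by rewrite -ltnS.
  by rewrite exprS mulrCA.
rewrite IHn frac_powS IH -natrM -natrD; congr (_%:R).
rewrite binS mulnDl subSS; congr (_ + _)%N.
have [nk|kn] := leqP n k; first by rewrite bin_small.
by rewrite mulnCA -expnS subnSK.
Qed.

Lemma fps_exp_div n : fps_div (fps_exp frac) (fps_poly (1 - 2 *: 'X)) n =
  \sum_(k < n.+1) ('C(n, k) * 2 ^ (n - k))%:R / k`!%:R.
Proof.
rewrite /fps_div -/geom /fps_mul.
have small k i : (i < k)%N -> fps_pow frac k i = 0.
  case: k => // k ik; rewrite frac_powS; case: i ik => // i ik.
  by rewrite frac_pow_geom bin_small.
have expE (i : 'I_n.+1) : fps_exp frac i = \sum_(k < n.+1) fps_pow frac k i / k`!%:R.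
  rewrite /fps_exp [RHS](bigID (fun k : 'I_n.+1 => (k < i.+1)%N)) /=.
  rewrite (big_ord_narrow (ltn_ord i)) /= [X in _ = _ + X]big1 ?addr0 //.
  by move=> k; rewrite -leqNgt => ik; rewrite small ?mul0r.
under eq_bigr => i _ do rewrite expE mulr_suml.
rewrite exchange_big /=; apply: eq_bigr => k _.
rewrite -frac_pow_geom /fps_mul mulr_suml; apply: eq_bigr => i _.
by rewrite mulrAC.
Qed.

Lemma egf_signed_placements (a : nat -> nat) :
  (forall l, a l = \sum_(k < l.+1) 2 ^ (l - k) * (l - k)`! * 'C(l, k) ^ 2)%N ->
  egf a =1 fps_div (fps_exp frac) (fps_poly (1 - 2 *: 'X)).
Proof.
move=> aE n; rewrite fps_exp_div /egf aE natr_sum mulr_suml; apply: eq_bigr => k _.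
have kn : (k <= n)%N by rewrite -ltnS.
have f0 m : m`!%:R != 0 :> rat by rewrite pnatr_eq0 -lt0n fact_gt0.
apply/eqP; rewrite eqr_div // -!natrM -(bin_fact kn); apply/eqP; congr (_%:R).
ring.
Qed.

End GeneratingFunction.

(** * Orbits on the flag variety *)

Section Orbits.
Variables (C : numClosedFieldType) (l : nat).
Implicit Types (b g h u : 'M[C]_(l.*2.+1)).
Local Notation b0 := (borel0 C (l.*2.+1)).

Lemma e0E : e0 C l = delta_mx (mid l) 0.
Proof.
apply/colP => i; rewrite !mxE eqxx andbT -val_eqE /= val_mid /blabel.
by congr (nat_of_bool _)%:R; have := ltn_ord i; do ?case: ifP; lia.
Qed.

(** The diagonal entries at mirror positions are inverse to each other, and the
middle one is 1. *)
Lemma det_upO_fix b : upO_fix (mid l) b -> \det b = 1.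
Proof.
move=> [[Ob ub] bm]; rewrite -det_tr det_trig; last first.
  by apply/is_trig_mxP => i j ij; rewrite mxE ub.
rewrite (bigD1 (mid l)) //= mxE bm eqxx mul1r.
rewrite (bigID (fun i : 'I__ => (i < l)%N)) /=.
rewrite [X in _ * X](reindex_inj rev_ord_inj) /=.
rewrite [X in _ * X](eq_bigl (fun i : 'I_(l.*2.+1) => (i != mid l) && (i < l)%N)).
  rewrite -big_split big1 //= => i _; rewrite !mxE.
  have /matrixP/(_ (rev_ord i) (rev_ord i)) := Ob.
  rewrite !mxE eqxx (bigD1 (rev_ord i)) //= big1 ?addr0 => [|k ki].
    by rewrite mxE rev_ordK.
  rewrite mxE rev_ordK; have [lt|] := ltnP k (rev_ord i); last first.
    rewrite leq_eqVlt eq_sym val_eqE (negPf ki) => /= lt.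
    by rewrite [b k _]ub ?mulr0.
  by rewrite ub ?mul0r // /=; have := ltn_ord i; move: lt => /=; lia.
by move=> i /=; rewrite -!val_eqE /= val_mid; have := ltn_ord i; lia.
Qed.

Lemma in_B_SO_evenP b : in_B_SO_even b <-> upO_fix (mid l) b.
Proof.
rewrite /in_B_SO_even /in_SO_even /in_SO e0E -colE.
split=> [[[[/in_OP Ob _] /colP be] ub]|Bb].
  by split=> // i; have := be i; rewrite !mxE eqxx andbT.
have [[Ob ub] be] := Bb; split=> //; split.
  by split; [exact/in_OP | exact: det_upO_fix].
by apply/colP => i; rewrite !mxE be eqxx andbT.
Qed.

Lemma Ad_upO u : upO u -> Ad u b0 = b0.
Proof.
move=> Uu; have conj v X : upO v -> X \in b0 -> adj v *m X *m v \in b0.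
  move=> [Ov uv] /borel0P[aX uX]; apply/borel0P; split; first exact: adj_conj.
  have [_ uav] := upO_adj (conj Ov uv).
  by apply: upperM => //; apply: upperM.
apply/vspaceP => X; rewrite mem_Ad ?(proj1 Uu) //; last by case: Uu.
apply/idP/idP => [|/conj]; last exact.
move/(conj _ _ (upO_adj Uu)); rewrite adjK !mulmxA (isO_mulV (proj1 Uu)) mul1mx.
by rewrite -mulmxA (isO_mulV (proj1 Uu)) mulmx1.
Qed.

(** [Ad h borel0 = Ad (b g) borel0] means that the inverse of [b g] times [h] normalizes
[borel0], so that it is upper triangular. *)
Lemma Ad_orbit_eq g h : isO g -> isO h ->
  Ad_orbit (@in_B_SO_even C l) (Ad g b0) = Ad_orbit (@in_B_SO_even C l) (Ad h b0)
  <-> equivB (mid l) g h.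
Proof.
move=> Og Oh; split=> [E|].
  have : Ad_orbit (@in_B_SO_even C l) (Ad g b0) (Ad h b0).
    rewrite E; exists 1%:M; last by rewrite Ad1.
    exact/in_B_SO_evenP/upO_fix1.
  case=> b /in_B_SO_evenP Bb hE; have Ob : isO b by case: Bb => -[].
  have Obg := isOM Ob Og.
  have nu : Ad (adj (b *m g) *m h) b0 = b0.
    by rewrite (AdM _ (isO_adj Obg) Oh) hE -(AdM _ Ob Og) AdK.
  have Ou : isO (adj (b *m g) *m h) by apply: isOM => //; apply: isO_adj.
  exists b, (adj (b *m g) *m h); split=> //.
    by split=> //; apply: normalizer_borel0.
  by rewrite mulmxA (isO_mulV Obg) mul1mx.
case=> b [u [Bb Uu hE]]; have Ob : isO b by case: Bb => -[].
have Eh : Ad h b0 = Ad b (Ad g b0).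
  by rewrite hE (AdM _ (isOM Ob Og) (proj1 Uu)) (Ad_upO Uu) (AdM _ Ob Og).
rewrite Eh; apply/seteqP; split=> [_ [c /in_B_SO_evenP Bc ->]|_ [c /in_B_SO_evenP Bc ->]].
  exists (c *m adj b).
    by apply/in_B_SO_evenP/upO_fixM => //; apply: upO_fix_adj.
  have Oc : isO c by case: Bc => -[].
  by rewrite (AdM _ Oc (isO_adj Ob)) AdK.
exists (c *m b); first exact/in_B_SO_evenP/upO_fixM.
have Oc : isO c by case: Bc => -[].
by rewrite AdM.
Qed.

Definition code_orbit (w : seq letter) : set {vspace 'M[C]_(l.*2.+1)} :=
  Ad_orbit (@in_B_SO_even C l) (Ad (rep C l w) b0).

Lemma code_orbit_inj : {in codes l &, injective code_orbit}.
Proof.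
move=> w w' wl wl' /Ad_orbit_eq E.
by apply: (equivB_rep_inj (F := C) wl wl'); apply: E; apply: isO_rep.
Qed.

Lemma B_orbits_codes :
  B_orbits C l = [set code_orbit w | w in [set` codes l]]%classic.
Proof.
apply/seteqP; split=> [_ [b /borel_so_conj[g Og ->] <-]|_ [w wl <-]].
  have [w wl E] := equivB_rep Og.
  exists w => //; apply/esym/Ad_orbit_eq => //.
  exact: isO_rep.
exists (Ad (rep C l w) b0) => //; apply/borel_so_conj; exists (rep C l w) => //.
exact: isO_rep.
Qed.

Lemma finite_B_orbits : finite_set (B_orbits C l).
Proof. by rewrite B_orbits_codes; apply: finite_image; apply: finite_seq. Qed.

Lemma card_B_orbits : #|` fset_set (B_orbits C l)|%fset = size (codes l).
Proof.
have -> : B_orbits C l = [set` [fset code_orbit w | w in codes l]%fset]%classic.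
  rewrite B_orbits_codes; apply/seteqP; split=> [_ [w wl <-]|X /=].
    by apply/imfsetP; exists w.
  by move=> /imfsetP[w wl ->]; exists w.
rewrite set_fsetK card_in_imfset //=; last exact: code_orbit_inj.
by rewrite undup_id // uniq_codes.
Qed.

End Orbits.

Theorem proposition3p17 (R : realType) :
  (forall l : nat, finite_set (B_orbits R[i] l)) /\
  egf (fun l => #|` fset_set (B_orbits R[i] l)|%fset) =1
    fps_div (fps_exp (fps_div (fps_poly 'X) (fps_poly (1 - 2 *: 'X))))
            (fps_poly (1 - 2 *: 'X)).
Proof.
split=> [l|]; first exact: finite_B_orbits.
by apply: egf_signed_placements => l; rewrite -size_codes -(card_B_orbits R[i] l).
Qed.
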